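(* Let $k$ be a field of odd prime characteristic $p$ and let $q\in k^\times$ be an element of finite order $e$ such that $e\geq 2$ and such that $e$ divides $p-1$. Let $$A = k\langle x,y\ |\ x^p=0=y^p,\ yx=qxy\rangle ,$$ and let $B$ be a split local symmetric $k$-algebra such that there is a stable equivalence of Morita type between $A$ and $B$. We have $$\dim_k(J(B)/J(B)^2)\leq 2e.$$
   Context: $J(B)$ is the Jacobson radical. A finite-dimensional $k$-algebra $B$ is symmetric if $B\cong B^\vee=\mathrm{Hom}_k(B,k)$ as $B$-$B$-bimodules, and split local if $B/J(B)\cong k$. A stable equivalence of Morita type between $A$ and $B$ is given by an $A$-$B$-bimodule $M$ and a $B$-$A$-bimodule $N$, finitely generated projective as left and as right modules, such that $M\otimes_B N\cong A\oplus X$ and $N\otimes_A M\cong B\oplus Y$ for some projective $A$-$A$-bimodule $X$ and some projective $B$-$B$-bimodule $Y$. *)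

(* Defs.v *)
From HB Require Import structures.
From mathcomp Require Import all_boot all_algebra all_field.
From mathcomp Require Import finmap monalg.
From mathcomp Require Import boolp.

Set Implicit Arguments.
Unset Strict Implicit.
Unset Printing Implicit Defensive.

Import GRing.Theory.

Local Open Scope ring_scope.
Local Open Scope quotient_scope.

Section GeneratedSubmodule.
Variables (R : nzRingType) (V : lmodType R) (G : V -> Prop).

Definition gen_submod : {pred V} :=
  fun v => `[< forall S : {pred V},
                 submod_closed S -> (forall g, G g -> g \in S) -> v \in S >].

Lemma gen_submodP : submod_closed gen_submod.
Proof.
split=> [|a u v /asboolP uG /asboolP vG]; apply/asboolP => S clS GS.
  by case: clS.
by case: (clS) => _; apply; [exact: uG | exact: vG].
Qed.

Lemma gen_submod_gen g : G g -> g \in gen_submod.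
Proof. by move=> Gg; apply/asboolP => S _; apply. Qed.

Lemma gen_submod_min (S : {pred V}) :
  submod_closed S -> (forall g, G g -> g \in S) ->
  {subset gen_submod <= S}.
Proof. by move=> clS GS v /asboolP; apply. Qed.

HB.instance Definition _ :=
  GRing.isSubmodClosed.Build R V gen_submod gen_submodP.

End GeneratedSubmodule.

Section QuotientModule.
Variables (R : nzRingType) (V : lmodType R) (G : V -> Prop).

Definition lmod_quot : Type := Quotient.quot (gen_submod G).

HB.instance Definition _ := GRing.Zmodule.on lmod_quot.

Definition lq_pi (v : V) : lmod_quot := \pi_(Quotient.quot (gen_submod G)) v.
Definition lq_repr (x : lmod_quot) : V := repr (x : Quotient.quot (gen_submod G)).

Lemma lq_reprK x : lq_pi (lq_repr x) = x.
Proof. exact: reprK. Qed.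

Lemma lq_piE u v : (lq_pi u == lq_pi v) = (u - v \in gen_submod G).
Proof. by rewrite /lq_pi Quotient.idealrBE. Qed.

Lemma lq_piD u v : lq_pi (u + v) = lq_pi u + lq_pi v.
Proof. by rewrite /lq_pi -(raddfD (\pi_(Quotient.quot (gen_submod G)))). Qed.

Definition lq_scale (a : R) (x : lmod_quot) : lmod_quot :=
  lq_pi (a *: lq_repr x).

Lemma lq_piZ a v : lq_pi (a *: v) = lq_scale a (lq_pi v).
Proof.
apply/eqP; rewrite lq_piE -scalerBr rpredZ // -lq_piE.
by rewrite lq_reprK.
Qed.

Fact lq_scaleA a b x : lq_scale a (lq_scale b x) = lq_scale (a * b) x.
Proof. by rewrite -[x]lq_reprK -!lq_piZ scalerA. Qed.
Fact lq_scale1 : left_id 1 lq_scale.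
Proof. by move=> x; rewrite -[x]lq_reprK -lq_piZ scale1r. Qed.
Fact lq_scaleDr : right_distributive lq_scale +%R.
Proof.
move=> a x y; rewrite -[x]lq_reprK -[y]lq_reprK -lq_piD -!lq_piZ.
by rewrite scalerDr lq_piD.
Qed.
Fact lq_scaleDl x : {morph lq_scale^~ x : a b / a + b}.
Proof.
by move=> a b /=; rewrite -[x]lq_reprK -!lq_piZ scalerDl lq_piD.
Qed.

HB.instance Definition _ := GRing.Zmodule_isLmodule.Build R lmod_quot
  lq_scaleA lq_scale1 lq_scaleDr lq_scaleDl.

Lemma lq_pi_linear : linear lq_pi.
Proof. by move=> a u v; rewrite lq_piD lq_piZ. Qed.

HB.instance Definition _ :=
  GRing.isLinear.Build R V lmod_quot *:%R lq_pi lq_pi_linear.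

Lemma lq_pi_eq0 v : (lq_pi v == 0) = (v \in gen_submod G).
Proof. by rewrite -[0](raddf0 lq_pi) lq_piE subr0. Qed.

End QuotientModule.

Section QuotientLift.
Variables (R : nzRingType) (V W : lmodType R) (G : V -> Prop).
Variables (f : {linear V -> W}).
Hypothesis fG : forall g, G g -> f g = 0.

Lemma gen_submod_ker v : v \in gen_submod G -> f v = 0.
Proof.
move=> /(@gen_submod_min _ _ _ [pred u | f u == 0]) vG; apply/eqP/vG => [|g Gg].
  split=> [|a u w /eqP fu /eqP fw]; first by rewrite inE raddf0.
  by rewrite inE linearP fu fw scaler0 addr0.
by rewrite inE fG.
Qed.

Definition lq_lift (x : lmod_quot G) : W := f (lq_repr x).

Lemma lq_lift_pi v : lq_lift (lq_pi G v) = f v.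
Proof.
apply/eqP; rewrite -subr_eq0 -raddfB; apply/eqP/gen_submod_ker.
by rewrite -lq_piE lq_reprK.
Qed.

Lemma lq_lift_linear : linear lq_lift.
Proof.
move=> a x y; rewrite -[x]lq_reprK -[y]lq_reprK -linearP !lq_lift_pi.
exact: linearP.
Qed.

End QuotientLift.

Section FreeModule.
Variables (R : nzRingType) (K : choiceType) (W : lmodType R) (h : K -> W).

Definition free_ext (g : {malg R[K]}) : W :=
  \sum_(x <- msupp g) g@_x *: h x.

Lemma free_extEw (d : {fset K}) g :
  (msupp g `<=` d)%fset -> free_ext g = \sum_(x <- d) g@_x *: h x.
Proof.
move=> le; rewrite /free_ext (big_fset_incl _ le) // => x _ /mcoeff_outdom ->.
by rewrite scale0r.
Qed.

Lemma free_ext_linear : linear free_ext.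
Proof.
move=> a u v; set d := (msupp u `|` msupp v)%fset.
have led : (msupp (a *: u + v) `<=` d)%fset.
  apply: fsubset_trans (msuppD_le _ _) _; apply: fsetSU; exact: msuppZ_le.
rewrite (free_extEw led) (free_extEw (fsubsetUl _ _ : msupp u `<=` d)%fset).
rewrite (free_extEw (fsubsetUr _ _ : msupp v `<=` d)%fset).
rewrite scaler_sumr -big_split /=; apply: eq_bigr => x _.
by rewrite mcoeffD mcoeffZ scalerDl scalerA.
Qed.

HB.instance Definition _ :=
  GRing.isLinear.Build R {malg R[K]} W *:%R free_ext free_ext_linear.

Lemma free_extU x : free_ext << x >> = h x.
Proof.
rewrite (free_extEw (msuppU_le : msupp << x >> `<=` [fset x])%fset).
by rewrite big_seq_fset1 mcoeffUU scale1r.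
Qed.

End FreeModule.

Lemma free_linear_eq (R : nzRingType) (K : choiceType) (W : lmodType R)
    (f g : {linear {malg R[K]} -> W}) :
  (forall x, f << x >> = g << x >>) -> f =1 g.
Proof.
move=> fg u; rewrite (monalgE u) !raddf_sum; apply: eq_bigr => x _.
have -> : << u@_x *g x >> = u@_x *: << x >> :> {malg R[K]}.
  by apply/malgP => y; rewrite mcoeffZ !mcoeffU mulrnAr mulr1.
have Z (h : {linear {malg R[K]} -> W}) c v : h (c *: v) = c *: h v.
  exact: linearZ.
exact: etrans (Z f _ _) (etrans (congr1 _ (fg x)) (esym (Z g _ _))).
Qed.

(* [k] acts centrally: both actions are [k]-bilinear for the single
   [k]-module structure of the carrier. *)

Record bimodule (k : fieldType) (A B : algType k) := Bimodule {
  bimod_car :> lmodType k;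
  lact : A -> bimod_car -> bimod_car;
  ract : bimod_car -> B -> bimod_car;
  lact_linearl : forall m, linear (lact^~ m);
  lact_linearr : forall a, linear (lact a);
  ract_linearl : forall b, linear (ract^~ b);
  ract_linearr : forall m, linear (ract m);
  lact1 : forall m, lact 1 m = m;
  ract1 : forall m, ract m 1 = m;
  lactM : forall a a' m, lact (a * a') m = lact a (lact a' m);
  ractM : forall m b b', ract m (b * b') = ract (ract m b) b';
  lractA : forall a m b, ract (lact a m) b = lact a (ract m b)
}.

Arguments lact {k A B b0} : rename.
Arguments ract {k A B b0} : rename.

Section BimoduleTheory.
Variables (k : fieldType) (A B : algType k).

Lemma linear_eqs (U V : lmodType k) (f : U -> V) : linear f ->
  [/\ forall c u, f (c *: u) = c *: f u & {morph f : u v / u + v}].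
Proof.
move=> lf; have fD : {morph f : u v / u + v}.
  by move=> u v; have := lf 1 u v; rewrite !scale1r.
have f0 : f 0 = 0 by apply: (addrI (f 0)); rewrite -fD !addr0.
by split=> // c u; have := lf c u 0; rewrite f0 !addr0.
Qed.

Variable M : bimodule A B.

Lemma lactDl (m : M) : {morph lact^~ m : a a' / a + a'}.
Proof. by have [] := linear_eqs (lact_linearl m). Qed.
Lemma lactZl c (a : A) (m : M) : lact (c *: a) m = c *: lact a m.
Proof. by have [-> _] := linear_eqs (lact_linearl m). Qed.
Lemma lactDr (a : A) : {morph lact a : m n / m + n :> M}.
Proof. by have [] := linear_eqs (@lact_linearr k A B M a). Qed.
Lemma lactZr c (a : A) (m : M) : lact a (c *: m) = c *: lact a m.
Proof. by have [-> _] := linear_eqs (@lact_linearr k A B M a). Qed.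
Lemma ractDl (b : B) : {morph ract^~ b : m n / m + n :> M}.
Proof. by have [] := linear_eqs (@ract_linearl k A B M b). Qed.
Lemma ractZl c (m : M) (b : B) : ract (c *: m) b = c *: ract m b.
Proof. by have [-> _] := linear_eqs (@ract_linearl k A B M b). Qed.
Lemma ractDr (m : M) : {morph ract m : b b' / b + b'}.
Proof. by have [] := linear_eqs (ract_linearr m). Qed.
Lemma ractZr c (m : M) (b : B) : ract m (c *: b) = c *: ract m b.
Proof. by have [-> _] := linear_eqs (ract_linearr m). Qed.

(* M as a left A-module, and as a right B-module, i.e. a left module over
   the converse ring B^c *)
Definition left_mod : Type := M.
HB.instance Definition _ := GRing.Zmodule.on left_mod.
HB.instance Definition _ := GRing.Zmodule_isLmodule.Build A left_mod
  (fun a a' m => esym (@lactM k A B M a a' m)) (@lact1 k A B M)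
  lactDr lactDl.

Definition right_mod : Type := M.
HB.instance Definition _ := GRing.Zmodule.on right_mod.
HB.instance Definition _ := GRing.Zmodule_isLmodule.Build B^c right_mod
  (fun b b' m => esym (@ractM k A B M m b' b)) (@ract1 k A B M)
  ractDl ractDr.

End BimoduleTheory.

Section ModuleProperties.
Variables (R : nzRingType) (P : lmodType R).

Definition fin_gen : Prop :=
  exists (n : nat) (g : 'I_n -> P),
    forall v, exists c : 'I_n -> R, v = \sum_i c i *: g i.

Definition projective : Prop :=
  forall (U V : lmodType R) (g : {linear U -> V}) (f : {linear P -> V}),
    (forall v, exists u, g u = v) ->
    exists h : {linear P -> U}, forall x, g (h x) = f x.

End ModuleProperties.

Section BimoduleMorphisms.
Variables (k : fieldType) (A B : algType k).

Definition bimod_hom (M N : bimodule A B) (f : M -> N) : Prop :=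
  [/\ linear f,
      forall a m, f (lact a m) = lact a (f m) &
      forall m b, f (ract m b) = ract (f m) b].

Definition bimod_iso (M N : bimodule A B) : Prop :=
  exists2 f : M -> N, bimod_hom f & bijective f.

(* bimodules are the modules over the enveloping algebra of A and B, so this
   is the lifting property of projective modules in that category *)
Definition bimod_projective (P : bimodule A B) : Prop :=
  forall (U V : bimodule A B) (g : U -> V) (f : P -> V),
    bimod_hom g -> bimod_hom f -> (forall v, exists u, g u = v) ->
    exists2 h : P -> U, bimod_hom h & forall x, g (h x) = f x.

End BimoduleMorphisms.

Section RegularBimodule.
Variables (k : fieldType) (A : algType k).

Fact regular_linearl (m : A) : linear ( *%R^~ m).
Proof. by move=> c u v; rewrite mulrDl scalerAl. Qed.
Fact regular_linearr (a : A) : linear ( *%R a).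
Proof. by move=> c u v; rewrite mulrDr scalerAr. Qed.

Definition regular_bimod : bimodule A A :=
  @Bimodule k A A A *%R *%R regular_linearl regular_linearr
    regular_linearl regular_linearr (@mul1r A) (@mulr1 A)
    (fun a a' m => esym (mulrA a a' m)) (@mulrA A)
    (fun a m b => esym (mulrA a m b)).

End RegularBimodule.

Section DualBimodule.
Variables (k : fieldType) (B : falgType k).
Local Notation Bdual := 'Hom(B, k^o).

(* (a . f)(x) = f (x a) and (f . b)(x) = f (b x) *)
Definition dual_lact (a : B) (f : Bdual) : Bdual := (f \o amulr a)%VF.
Definition dual_ract (f : Bdual) (b : B) : Bdual := (f \o amull b)%VF.

Lemma dual_lactE a f x : dual_lact a f x = f (x * a).
Proof. by rewrite comp_lfunE lfunE. Qed.
Lemma dual_ractE f b x : dual_ract f b x = f (b * x).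
Proof. by rewrite comp_lfunE lfunE. Qed.

Let dualE := (dual_lactE, dual_ractE).

Fact dual_lact_linearl f : linear (dual_lact^~ f).
Proof.
move=> c u v; apply/lfunP => x.
by rewrite add_lfunE scale_lfunE !dualE mulrDr -scalerAr linearP.
Qed.
Fact dual_lact_linearr a : linear (dual_lact a).
Proof.
by move=> c u v; apply/lfunP => x; rewrite !(add_lfunE, scale_lfunE, dualE).
Qed.
Fact dual_ract_linearl b : linear (dual_ract^~ b).
Proof.
by move=> c u v; apply/lfunP => x; rewrite !(add_lfunE, scale_lfunE, dualE).
Qed.
Fact dual_ract_linearr f : linear (dual_ract f).
Proof.
move=> c u v; apply/lfunP => x.
by rewrite add_lfunE scale_lfunE !dualE mulrDl -scalerAl linearP.
Qed.
Fact dual_lact1 f : dual_lact 1 f = f.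
Proof. by apply/lfunP => x; rewrite dualE mulr1. Qed.
Fact dual_ract1 f : dual_ract f 1 = f.
Proof. by apply/lfunP => x; rewrite dualE mul1r. Qed.
Fact dual_lactM a a' f : dual_lact (a * a') f = dual_lact a (dual_lact a' f).
Proof. by apply/lfunP => x; rewrite !dualE mulrA. Qed.
Fact dual_ractM f b b' : dual_ract f (b * b') = dual_ract (dual_ract f b) b'.
Proof. by apply/lfunP => x; rewrite !dualE mulrA. Qed.
Fact dual_lractA a f b :
  dual_ract (dual_lact a f) b = dual_lact a (dual_ract f b).
Proof. by apply/lfunP => x; rewrite !dualE mulrA. Qed.

Definition dual_bimod : bimodule B B :=
  @Bimodule k B B Bdual dual_lact dual_ract dual_lact_linearl dual_lact_linearr
    dual_ract_linearl dual_ract_linearr dual_lact1 dual_ract1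
    dual_lactM dual_ractM dual_lractA.

End DualBimodule.

Section DirectSum.
Variables (k : fieldType) (A B : algType k) (M N : bimodule A B).

Definition dsum_lact (a : A) (x : (M * N)%type) : (M * N)%type :=
  (lact a x.1, lact a x.2).
Definition dsum_ract (x : (M * N)%type) (b : B) : (M * N)%type :=
  (ract x.1 b, ract x.2 b).

Fact dsum_lact_linearl x : linear (dsum_lact^~ x).
Proof. by move=> c u v; congr pair; rewrite /= lact_linearl. Qed.
Fact dsum_lact_linearr a : linear (dsum_lact a).
Proof. by move=> c u v; congr pair; rewrite /= lact_linearr. Qed.
Fact dsum_ract_linearl b : linear (dsum_ract^~ b).
Proof. by move=> c u v; congr pair; rewrite /= ract_linearl. Qed.
Fact dsum_ract_linearr x : linear (dsum_ract x).
Proof. by move=> c u v; congr pair; rewrite /= ract_linearr. Qed.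
Fact dsum_lact1 x : dsum_lact 1 x = x.
Proof. by case: x => m n; rewrite /dsum_lact !lact1. Qed.
Fact dsum_ract1 x : dsum_ract x 1 = x.
Proof. by case: x => m n; rewrite /dsum_ract !ract1. Qed.
Fact dsum_lactM a a' x : dsum_lact (a * a') x = dsum_lact a (dsum_lact a' x).
Proof. by rewrite /dsum_lact !lactM. Qed.
Fact dsum_ractM x b b' : dsum_ract x (b * b') = dsum_ract (dsum_ract x b) b'.
Proof. by rewrite /dsum_ract !ractM. Qed.
Fact dsum_lractA a x b :
  dsum_ract (dsum_lact a x) b = dsum_lact a (dsum_ract x b).
Proof. by rewrite /dsum_ract /dsum_lact !lractA. Qed.

Definition dsum_bimod : bimodule A B :=
  @Bimodule k A B (M * N)%type dsum_lact dsum_ract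
    dsum_lact_linearl dsum_lact_linearr
    dsum_ract_linearl dsum_ract_linearr dsum_lact1 dsum_ract1
    dsum_lactM dsum_ractM dsum_lractA.

End DirectSum.

Section TensorProduct.
Variables (k : fieldType) (A B C : algType k).
Variables (M : bimodule A B) (N : bimodule B C).

Local Notation F := {malg k[(M * N)%type]}.
Local Notation "[ m & n ]" := (<< (m, n) >> : F) (at level 0).

Variant tensor_rel : F -> Prop :=
| TensorLinl c m m' n :
    tensor_rel ([c *: m + m' & n] - (c *: [m & n] + [m' & n]))
| TensorLinr m c n n' :
    tensor_rel ([m & c *: n + n'] - (c *: [m & n] + [m & n']))
| TensorBal m b n :
    tensor_rel ([ract m b & n] - [m & lact b n]).

Definition tensor : lmodType k := lmod_quot tensor_rel.

Definition tens (m : M) (n : N) : tensor := lq_pi tensor_rel [m & n].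

Lemma tensor_relP u v :
  tensor_rel (u - v) -> lq_pi tensor_rel u = lq_pi tensor_rel v.
Proof. by move/gen_submod_gen => uv; apply/eqP; rewrite lq_piE. Qed.

Lemma tens_linearl n : linear (tens^~ n).
Proof.
by move=> c m m'; rewrite /tens -linearP; exact/tensor_relP/TensorLinl.
Qed.

Lemma tens_linearr m : linear (tens m).
Proof.
by move=> c n n'; rewrite /tens -linearP; exact/tensor_relP/TensorLinr.
Qed.

Lemma tens_bal m b n : tens (ract m b) n = tens m (lact b n).
Proof. exact/tensor_relP/TensorBal. Qed.

Section Lift.
Variables (W : lmodType k) (h : M -> N -> W).
Hypothesis h_linl : forall n, linear (h^~ n).
Hypothesis h_linr : forall m, linear (h m).
Hypothesis h_bal : forall m b n, h (ract m b) n = h m (lact b n).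

Let hF : {linear F -> W} := free_ext (fun x : M * N => h x.1 x.2).

Fact tensor_lift_rel g : tensor_rel g -> hF g = 0.
Proof.
have hP c (u v : F) : hF (c *: u + v) = c *: hF u + hF v.
  exact: (free_ext_linear (fun x : M * N => h x.1 x.2)).
case=> [c m m' n|m c n n'|m b n]; rewrite raddfB.
- apply/eqP; rewrite subr_eq0; apply/eqP; apply: etrans (esym (hP _ _ _)).
  by rewrite /= !free_extU /= h_linl.
- apply/eqP; rewrite subr_eq0; apply/eqP; apply: etrans (esym (hP _ _ _)).
  by rewrite /= !free_extU /= h_linr.
- by rewrite /= !free_extU /= h_bal subrr.
Qed.

Definition tensor_lift : tensor -> W := @lq_lift _ _ _ tensor_rel hF.

Lemma tensor_lift_linear : linear tensor_lift.
Proof. exact: lq_lift_linear tensor_lift_rel. Qed.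

Lemma tensor_lift_tens m n : tensor_lift (tens m n) = h m n.
Proof.
exact: etrans (lq_lift_pi tensor_lift_rel _)
              (free_extU (fun x : M * N => h x.1 x.2) (m, n)).
Qed.

End Lift.

Lemma tensor_ext (W : lmodType k) (f g : tensor -> W) :
  linear f -> linear g -> (forall m n, f (tens m n) = g (tens m n)) -> f =1 g.
Proof.
move=> lf lg fg x; rewrite -[x]lq_reprK; move: (lq_repr x).
have cl (h : tensor -> W) : linear h -> linear (h \o lq_pi tensor_rel).
  by move=> lh c u v; rewrite /= linearP lh.
pose f' : {linear F -> W} := HB.pack (f \o lq_pi tensor_rel : F -> W)
  (GRing.isLinear.Build k F W *:%R _ (cl f lf)).
pose g' : {linear F -> W} := HB.pack (g \o lq_pi tensor_rel : F -> W)
  (GRing.isLinear.Build k F W *:%R _ (cl g lg)).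
by apply: (@free_linear_eq _ _ _ f' g') => -[m n]; exact: fg.
Qed.

Definition tensor_lact (a : A) : tensor -> tensor :=
  tensor_lift (fun m n => tens (lact a m) n).
Definition tensor_ract (x : tensor) (c : C) : tensor :=
  tensor_lift (fun m n => tens m (ract n c)) x.

Fact tensor_lact_linearr a : linear (tensor_lact a).
Proof.
apply: tensor_lift_linear => [n c m m'|m|m b n].
- by rewrite lact_linearr tens_linearl.
- exact: tens_linearr.
- by rewrite -lractA tens_bal.
Qed.

Lemma tensor_lact_tens a m n : tensor_lact a (tens m n) = tens (lact a m) n.
Proof.
apply: (@tensor_lift_tens _ (fun m n => tens (lact a m) n))
  => [n' c m1 m2|m'|m' b n'].
- by rewrite lact_linearr tens_linearl.
- exact: tens_linearr.
- by rewrite -lractA tens_bal.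
Qed.

Fact tensor_ract_linearl c : linear (tensor_ract^~ c).
Proof.
apply: tensor_lift_linear => [n|m d n n'|m b n].
- exact: tens_linearl.
- by rewrite ract_linearl tens_linearr.
- by rewrite lractA tens_bal.
Qed.

Lemma tensor_ract_tens m n c : tensor_ract (tens m n) c = tens m (ract n c).
Proof.
apply: (@tensor_lift_tens _ (fun m n => tens m (ract n c)))
  => [n'|m' d n1 n2|m' b n'].
- exact: tens_linearl.
- by rewrite ract_linearl tens_linearr.
- by rewrite lractA tens_bal.
Qed.

Let lin_comp (f g : tensor -> tensor) : linear f -> linear g -> linear (f \o g).
Proof. by move=> lf lg c u v; rewrite /= lg lf. Qed.
Let lin_id : linear (@id tensor). Proof. by []. Qed.
Let lin_comb (f g : tensor -> tensor) d :
  linear f -> linear g -> linear (fun x => d *: f x + g x).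
Proof.
move=> lf lg c u v; rewrite lf lg !scalerDr !scalerA mulrC.
by rewrite addrACA.
Qed.

Fact tensor_lact_linearl x : linear (tensor_lact^~ x).
Proof.
move=> c a a'; move: x.
apply: tensor_ext => [||m n]; first exact: tensor_lact_linearr.
  by apply: lin_comb; exact: tensor_lact_linearr.
by rewrite !tensor_lact_tens lact_linearl tens_linearl.
Qed.
Fact tensor_ract_linearr x : linear (tensor_ract x).
Proof.
move=> d c c'; move: x.
apply: tensor_ext => [||m n]; first exact: tensor_ract_linearl.
  by apply: lin_comb; exact: tensor_ract_linearl.
by rewrite !tensor_ract_tens ract_linearr tens_linearr.
Qed.
Fact tensor_lact1 x : tensor_lact 1 x = x.
Proof.
move: x; apply: tensor_ext lin_id _ => [|m n]; first exact: tensor_lact_linearr.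
by rewrite tensor_lact_tens lact1.
Qed.
Fact tensor_ract1 x : tensor_ract x 1 = x.
Proof.
move: x; apply: tensor_ext lin_id _ => [|m n]; first exact: tensor_ract_linearl.
by rewrite tensor_ract_tens ract1.
Qed.
Fact tensor_lactM a a' x :
  tensor_lact (a * a') x = tensor_lact a (tensor_lact a' x).
Proof.
move: x; apply: tensor_ext => [||m n]; first exact: tensor_lact_linearr.
  by apply: lin_comp; exact: tensor_lact_linearr.
by rewrite !tensor_lact_tens lactM.
Qed.
Fact tensor_ractM x c c' :
  tensor_ract x (c * c') = tensor_ract (tensor_ract x c) c'.
Proof.
move: x; apply: tensor_ext => [||m n]; first exact: tensor_ract_linearl.
  exact: lin_comp (tensor_ract_linearl c') (tensor_ract_linearl c).
by rewrite !tensor_ract_tens ractM.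
Qed.
Fact tensor_lractA a x c :
  tensor_ract (tensor_lact a x) c = tensor_lact a (tensor_ract x c).
Proof.
move: x; apply: tensor_ext => [||m n].
- exact: lin_comp (tensor_ract_linearl c) (tensor_lact_linearr a).
- exact: lin_comp (tensor_lact_linearr a) (tensor_ract_linearl c).
- by rewrite !(tensor_lact_tens, tensor_ract_tens).
Qed.

Definition tensor_bimod : bimodule A C :=
  @Bimodule k A C tensor tensor_lact tensor_ract
    tensor_lact_linearl tensor_lact_linearr
    tensor_ract_linearl tensor_ract_linearr tensor_lact1 tensor_ract1
    tensor_lactM tensor_ractM tensor_lractA.

End TensorProduct.

Definition biprojective (k : fieldType) (A B : algType k) (M : bimodule A B) :
    Prop :=
  [/\ @fin_gen A (left_mod M), @projective A (left_mod M),
      @fin_gen B^c (right_mod M) & @projective B^c (right_mod M)].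

Definition stable_equiv_Morita (k : fieldType) (A B : algType k) : Prop :=
  exists (M : bimodule A B) (N : bimodule B A),
    [/\ biprojective M, biprojective N,
        exists2 X : bimodule A A, bimod_projective X &
          bimod_iso (tensor_bimod M N) (dsum_bimod (regular_bimod A) X) &
        exists2 Y : bimodule B B, bimod_projective Y &
          bimod_iso (tensor_bimod N M) (dsum_bimod (regular_bimod B) Y)].

Definition symmetric_alg (k : fieldType) (B : falgType k) : Prop :=
  bimod_iso (regular_bimod B) (dual_bimod B).

Section Jacobson.
Variable R : nzRingType.

Definition left_ideal (I : R -> Prop) : Prop :=
  [/\ I 0, forall u v, I u -> I v -> I (u + v) & forall a u, I u -> I (a * u)].

Definition maximal_left_ideal (I : R -> Prop) : Prop :=
  [/\ left_ideal I, ~ I 1 &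
      forall L : R -> Prop, left_ideal L -> (forall u, I u -> L u) ->
        ~ L 1 -> forall u, L u -> I u].

Definition in_jacobson (u : R) : Prop :=
  forall I, maximal_left_ideal I -> I u.

Definition two_sided_ideal (I : R -> Prop) : Prop :=
  left_ideal I /\ forall u a, I u -> I (u * a).

Definition in_gen_ideal (G : R -> Prop) (u : R) : Prop :=
  forall I, two_sided_ideal I -> (forall g, G g -> I g) -> I u.

End Jacobson.

Section JacobsonRadical.
Variables (k : fieldType) (B : falgType k).

Lemma in_jacobson_submod :
  submod_closed ((fun u : B => `[< in_jacobson u >]) : {pred B}).
Proof.
split=> [|a u v /asboolP Ju /asboolP Jv]; apply/asboolP => I mI.
  by case: (mI) => -[].
case: (mI) => -[I0 ID IM] _ _; apply: ID; last exact: Jv mI.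
by rewrite -[u]mul1r scalerAl; exact: IM (Ju _ mI).
Qed.

Lemma submod_vspace (V : vectType k) (S : {pred V}) :
  submod_closed S -> exists U : {vspace V}, forall v, (v \in U) = (v \in S).
Proof.
move=> [S0 Slin].
pose P n := `[< exists2 U : {vspace V}, {subset U <= S} & \dim U = n >].
have exP : exists n, P n.
  exists 0%N; apply/asboolP; exists 0%VS; last exact: dimv0.
  by move=> v /[!memv0] /eqP ->.
have leP n : P n -> (n <= \dim {:V})%N.
  by move=> /asboolP [U _ <-]; exact/dimvS/subvf.
case: (ex_maxnP exP leP) => n /asboolP [U US dU] maxn.
exists U => v; apply/idP/idP => [/US //|Sv].
have UvS : {subset (U + <[v]>)%VS <= S}.
  move=> _ /memv_addP [u Uu [_ /vlineP [c ->] ->]].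
  by rewrite addrC; apply: Slin => //; exact: US.
have : (\dim (U + <[v]>) <= \dim U)%N.
  by rewrite dU; apply: maxn; apply/asboolP; exists (U + <[v]>)%VS.
rewrite (geq_leqif (dimv_leqif_sup (addvSl U <[v]>))).
by rewrite subv_add => /andP [_]; rewrite -memvE.
Qed.

Definition jacobson : {vspace B} :=
  projT1 (cid (submod_vspace in_jacobson_submod)).

Lemma mem_jacobson (u : B) : u \in jacobson <-> in_jacobson u.
Proof.
rewrite /jacobson; case: cid => U /= ->.
by split=> [/asboolP|?]; [|apply/asboolP].
Qed.

Lemma jacobson_sqr_sub : (jacobson ^+ 2 <= jacobson)%VS.
Proof.
apply/prodvP => u v _ /mem_jacobson Jv; apply/mem_jacobson => I mI.
by case: (mI) => -[_ _ IM] _ _; exact: IM (Jv _ mI).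
Qed.

(* dim_k (J / J^2); the subtraction is exact by jacobson_sqr_sub *)
Definition dim_jacobson_layer : nat := \dim jacobson - \dim (jacobson ^+ 2)%VS.

(* B / J(B) is isomorphic to k: there is a k-algebra morphism from B to k
   (necessarily onto) whose kernel is J(B) *)
Definition split_local : Prop :=
  exists f : {lrmorphism B -> k^o}, forall b, (f b == 0) = (b \in jacobson).

End JacobsonRadical.

Section QuantumCompleteIntersection.
Variables (k : fieldType) (p : nat) (q : k).

Local Notation kxy := {malg k[{fmonom bool}]}.
Local Notation x := (<< fmu false >> : kxy).
Local Notation y := (<< fmu true >> : kxy).

Variant qci_rel : kxy -> Prop :=
| QciX : qci_rel (x ^+ p)
| QciY : qci_rel (y ^+ p)
| QciXY : qci_rel (y * x - q *: (x * y)).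

(* A = k< x, y | x^p = 0 = y^p, y x = q x y > up to isomorphism: the quotient
   of the free algebra (monoid algebra of the free monoid on the two letters
   false, true) by the two-sided ideal generated by qci_rel *)
Definition is_qci (A : algType k) : Prop :=
  exists2 f : {lrmorphism kxy -> A},
    forall a, exists u, f u = a &
    forall u, f u = 0 <-> in_gen_ideal qci_rel u.

End QuantumCompleteIntersection.

(* Main.v *)
From HB Require Import structures.
Require Import Defs.
From mathcomp Require Import all_boot all_algebra all_field.
From mathcomp Require Import finmap monalg.

Import GRing.Theory.
Local Open Scope ring_scope.

Set Implicit Arguments.
Unset Strict Implicit.
Unset Printing Implicit Defensive.

(** Write J for the Jacobson radical of B, eps : B -> k for the augmentation
    with kernel J, and let lam run through the linear forms on B that vanish on
    1 and on J^2.  These forms are the dual of J / J^2, and each of them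
    satisfies lam (b c) = eps b lam c + lam b eps c; in particular it is a
    trace form.  So the theorem says that 2e linear conditions on lam suffice
    to force lam = 0.

    A trace form transfers along a bimodule that is finitely generated
    projective on the right: if e_i, f_i is a dual basis of M over B, then
    psi a = sum_i lam (f_i (a e_i)) is a trace form on A.  Transferring psi
    further along N gives the transfer of lam along N (x) M = B + Y, that is,
    lam plus the contribution of the projective bimodule Y.  The latter is 0,
    so psi determines lam (form_transfer).

    To describe psi, let V = M / MJ, on which A acts through rho.  Let B act on
    k[t] / (t^2) by b |-> eps b + lam b t.  Tensoring M with this module gives
    an extension of V by V, described by a rho-derivation D from A to the
    endomorphisms of V, and psi = tr D.  If z is a central element of A that acts on V by a map which
    factors through a free A-module, then the extension splits when it is
    pulled back along z: there is u with D a rho z = u rho a - rho a u for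
    all a.  This conclusion holds for every nilpotent central z
    (central_nilpotent_inner).  Indeed V corresponds to the simple B-module
    under the stable equivalence, so z acts on V as a scalar c plus a map that
    factors through a free module; and if c is not 0, then z - c is invertible,
    so that V itself is projective and the extension splits.

    In A the powers x^i and y^i with e | i are central.  Hence:
    - if i > e, then tr D(x^i) = 0 and tr D(y^i) = 0, by the product rule and
      the relation for z = x^e or z = y^e;
    - if i, j > 0 and e divides both, then tr D(x^i y^j) = 0, by the product
      rule and the relation for z = x^i and z = y^j;
    - if i, j > 0 and e does not divide both, then x^i y^j is a multiple of a
      commutator, on which tr D vanishes.
    As A is spanned by the monomials x^i y^j, psi is determined by its values
    at x^i and y^i for 1 <= i <= e, which are 2e linear functions of lam. *)

(** * Dual bases and linear maps *)

(** The projectivity of P splits the surjection from a free module that a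
    finite generating family defines; the components of the splitting are the
    coordinate forms. *)
Lemma dual_basis_exists (R : nzRingType) (P : lmodType R) :
  fin_gen P -> projective P ->
  exists n (e : 'I_n -> P) (f : 'I_n -> {linear P -> R^o}),
    forall v, v = \sum_i f i v *: e i.
Proof.
move=> [n [e gen_e]] projP.
pose g (r : 'rV[R]_n) := \sum_i r 0 i *: e i.
have g_lin : linear g.
  move=> c r s; rewrite /g scaler_sumr -big_split /=; apply: eq_bigr => i _.
  by rewrite !mxE scalerDl scalerA.
pose gL : {linear 'rV[R]_n -> P} :=
  HB.pack g (GRing.isLinear.Build R 'rV[R]_n P *:%R g g_lin).
have [v|h hK] := projP _ _ gL (idfun : {linear P -> P}).
  have [c ->] := gen_e v; exists (\row_i c i).
  by apply: eq_bigr => i _; rewrite mxE.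
have f_lin i : linear (fun v => h v 0 i : R^o).
  by move=> c u v; rewrite linearP !mxE.
pose f i : {linear P -> R^o} :=
  HB.pack (fun v => h v 0 i : R^o)
    (GRing.isLinear.Build R P R^o *:%R _ (f_lin i)).
by exists n, e, f => v; rewrite -[LHS]hK.
Qed.

Section DualBases.
Variables (k : fieldType) (R B : algType k) (P : bimodule R B).

Definition right_dual_basis (I : finType) (e : I -> P) (f : I -> P -> B) :
    Prop :=
  [/\ forall i, linear (f i),
      forall i v b, f i (ract v b) = f i v * b
    & forall v, v = \sum_i ract (e i) (f i v)].

Definition left_dual_basis (I : finType) (e : I -> P) (f : I -> P -> R) :
    Prop :=
  [/\ forall i, linear (f i),
      forall i a v, f i (lact a v) = a * f i v
    & forall v, v = \sum_i lact (f i v) (e i)].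

Lemma right_dual_basis_exists :
  @fin_gen B^c (right_mod P) -> @projective B^c (right_mod P) ->
  exists n (e : 'I_n -> P) (f : 'I_n -> P -> B), right_dual_basis e f.
Proof.
move=> fgP prP; have [n [e [f def_v]]] := dual_basis_exists fgP prP.
have fM i (v : P) b : f i (ract v b) = (f i v : B) * b.
  exact: (linearZZ (f i) b (v : right_mod P)).
exists n, e, (fun i v => f i v); split=> // i c u v.
have -> : c *: u = ract u c%:A by rewrite ractZr ract1.
have -> : f i (ract u c%:A + v) = f i (ract u c%:A) + f i v by exact: raddfD.
by rewrite fM -scalerAr mulr1.
Qed.

Lemma left_dual_basis_exists :
  @fin_gen R (left_mod P) -> @projective R (left_mod P) ->
  exists n (e : 'I_n -> P) (f : 'I_n -> P -> R), left_dual_basis e f.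
Proof.
move=> fgP prP; have [n [e [f def_v]]] := dual_basis_exists fgP prP.
have fM i a (v : P) : f i (lact a v) = a * (f i v : R).
  exact: (linearZZ (f i) a (v : left_mod P)).
exists n, e, (fun i v => f i v); split=> // i c u v.
have -> : c *: u = lact c%:A u by rewrite lactZl lact1.
have -> : f i (lact c%:A u + v) = f i (lact c%:A u) + f i v by exact: raddfD.
by rewrite fM -scalerAl mul1r.
Qed.

End DualBases.

Section LinearMaps.
Variables (k : fieldType) (U V : lmodType k) (f : U -> V).
Hypothesis f_lin : linear f.

Lemma lin_add u v : f (u + v) = f u + f v.
Proof. by have [_ ->] := linear_eqs f_lin. Qed.

Lemma lin_scale c u : f (c *: u) = c *: f u.
Proof. by have [-> _] := linear_eqs f_lin. Qed.

Lemma lin0 : f 0 = 0.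
Proof. by rewrite -(scale0r (0 : U)) lin_scale scale0r. Qed.

Lemma lin_sum I (r : seq I) (F : I -> U) :
  f (\sum_(i <- r) F i) = \sum_(i <- r) f (F i).
Proof.
elim: r => [|i r IH]; last by rewrite !big_cons lin_add IH.
by rewrite !big_nil lin0.
Qed.

End LinearMaps.

Section LinearForms.
Variables (k : fieldType) (U : lmodType k) (f : U -> k).
Hypothesis f_lin : scalar f.

Lemma form_add u v : f (u + v) = f u + f v.
Proof. by have := f_lin 1 u v; rewrite scale1r mul1r. Qed.

Lemma form_scale c u : f (c *: u) = c * f u.
Proof. exact: (lin_scale (f_lin : linear (f : U -> k^o))). Qed.

Lemma form_sum I (r : seq I) (F : I -> U) :
  f (\sum_(i <- r) F i) = \sum_(i <- r) f (F i).
Proof. exact: (lin_sum (f_lin : linear (f : U -> k^o))). Qed.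

End LinearForms.

Lemma linear_comp (k : fieldType) (U V W : lmodType k) (f : V -> W)
    (g : U -> V) :
  linear f -> linear g -> linear (f \o g).
Proof. by move=> fL gL c u v /=; rewrite gL fL. Qed.

(** * Derivations along a matrix representation *)

Lemma eq_cols (k : fieldType) m n (X Y : 'M[k]_(m, n)) :
  (forall j, col j X = col j Y) -> X = Y.
Proof.
move=> XY; apply/matrixP => i j.
by have /matrixP/(_ i 0) := XY j; rewrite !mxE.
Qed.

Lemma col_mulmx (k : fieldType) m n p (X : 'M[k]_(m, n)) (Y : 'M[k]_(n, p)) j :
  col j (X *m Y) = X *m col j Y.
Proof. by rewrite !colE mulmxA. Qed.

(** [rho 1] need not be the identity matrix: below, rho describes a module as
    the image of an idempotent matrix, the coordinates being taken with respect
    to a dual basis. *)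
Section TwistedDerivations.
Variables (k : fieldType) (R : algType k) (n : nat) (rho D : R -> 'M[k]_n).
Hypothesis rhoM : forall a b, rho (a * b) = rho a *m rho b.
Hypothesis DM : forall a b, D (a * b) = D a *m rho b + rho a *m D b.

(** D is the class of an extension of the module rho by itself; [inner_on z]
    says that its pullback along the endomorphism rho z splits. *)
Definition inner_on (z : R) : Prop :=
  exists u, forall a, D a *m rho z = u *m rho a - rho a *m u.

Lemma inner_on_mul z w :
  (forall a, a * w = w * a) -> inner_on z -> inner_on (z * w).
Proof.
move=> cw [u uP]; exists (u *m rho w) => a.
by rewrite rhoM mulmxA uP mulmxBl -!mulmxA -!rhoM cw.
Qed.

(** D 1 is off-diagonal with respect to the idempotent rho 1, whereas rho a is
    a block of its diagonal. *)
Lemma mxtrace_rho_der1 a : \tr (rho a *m D 1) = 0.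
Proof.
have E : rho 1 *m D 1 *m rho 1 = 0.
  have := congr1 (mulmx (rho 1)) (DM 1 1).
  rewrite mulr1 mulmxDr !mulmxA -rhoM mulr1.
  by move/eqP; rewrite -subr_eq subrr => /eqP <-.
have -> : rho a = rho 1 *m (rho a *m rho 1) by rewrite -!rhoM mulr1 mul1r.
by rewrite -mulmxA mxtrace_mulC -!mulmxA (mulmxA (rho 1)) E mulmx0 mxtrace0.
Qed.

Lemma mxtrace_der1 : \tr (D 1) = 0.
Proof.
by rewrite -{1}(mulr1 1) DM mxtraceD [\tr (D 1 *m _)]mxtrace_mulC
           !mxtrace_rho_der1 addr0.
Qed.

Lemma mxtrace_der_comm a b : \tr (D (a * b)) = \tr (D (b * a)).
Proof.
rewrite !DM !mxtraceD addrC.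
by rewrite [X in X + _]mxtrace_mulC [X in _ + X]mxtrace_mulC.
Qed.

(** The trace is that of [u, rho a] rho b, and rho a commutes with rho b. *)
Lemma mxtrace_inner z a b :
  inner_on z -> a * b = b * a -> \tr (D a *m rho (z * b)) = 0.
Proof.
move=> [u uP] ab; rewrite rhoM mulmxA uP mulmxBl mxtraceD linearN /=.
by rewrite -!mulmxA [X in _ - X]mxtrace_mulC -!mulmxA -!rhoM ab subrr.
Qed.

(** A split self-extension deforms the character trivially. *)
Lemma mxtrace_inner1 a : inner_on 1 -> \tr (D a) = 0.
Proof.
move=> i1; rewrite -(mulr1 a) DM mxtraceD mxtrace_rho_der1 addr0.
by rewrite -[X in rho X]mulr1 mxtrace_inner // mulr1 mul1r.
Qed.

Lemma mxtrace_rho_der_exp x m s :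
  \tr (rho (x ^+ m) *m D (x ^+ s)) = s%:R * \tr (rho (x ^+ (m + s).-1) *m D x).
Proof.
elim: s m => [|s IH] m; first by rewrite mul0r expr0 mxtrace_rho_der1.
rewrite exprSr DM mulmxDr mxtraceD !mulmxA -rhoM -exprD.
rewrite mxtrace_mulC mulmxA -rhoM -exprS IH addSnnS addnS /=.
by rewrite -[s.+1]addn1 natrD mulrDl mul1r.
Qed.

(** Write x^i = x^(i-e) x^e.  One term of the derivative has a factor
    rho (x^e) next to D; the other is a multiple of
    tr rho(x^(i-e-1)) D(x) rho(x^e), and again D x meets rho (x^e). *)
Lemma mxtrace_der_exp_gt x e i :
  (e < i)%N -> inner_on (x ^+ e) -> \tr (D (x ^+ i)) = 0.
Proof.
move=> lt_ei inn; rewrite -(subnK (ltnW lt_ei)); set j := (i - e)%N.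
have j_gt0 : (0 < j)%N by rewrite subn_gt0.
have comm_x m l : x ^+ m * x ^+ l = x ^+ l * x ^+ m by rewrite -!exprD addnC.
rewrite exprD DM mxtraceD -[X in D _ *m rho X]mulr1.
rewrite mxtrace_inner ?mulr1 ?mul1r //.
rewrite add0r mxtrace_rho_der_exp mxtrace_mulC -(prednK j_gt0) addSn /= addnC.
by rewrite exprD mxtrace_inner ?mulr0 // (comm_x 1%N).
Qed.

Lemma mxtrace_der_mul z w :
  (forall a, a * z = z * a) -> inner_on z -> inner_on w ->
  \tr (D (z * w)) = 0.
Proof.
move=> cz inn_z inn_w; rewrite DM mxtraceD [X in _ + X]mxtrace_mulC.
rewrite -[X in rho X]mulr1 mxtrace_inner ?mulr1 ?mul1r // add0r.
by rewrite -[X in rho X]mulr1 mxtrace_inner ?mulr1 ?mul1r.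
Qed.

(** For c <> 0 the element z - c is invertible, with inverse given by a
    geometric series; as [inner_on] is inherited by central multiples, the
    extension then splits even without pulling back. *)
Lemma inner_on_nilpotent z (c : k) m :
  (forall a, a * z = z * a) -> z ^+ m = 0 -> inner_on (z - c%:A) -> inner_on z.
Proof.
move=> cz zm0; have [-> | c_neq0] := eqVneq c 0; first by rewrite scale0r subr0.
set s := \sum_(i < m) z ^+ (m.-1 - i) * c%:A ^+ i.
have comm_c (a : R) : a * c%:A = c%:A * a by rewrite mulr_algr mulr_algl.
have cX (a y : R) i : a * y = y * a -> a * y ^+ i = y ^+ i * a.
  by move=> ay; have := commrX i (ay : GRing.comm a y).
have cs a : a * s = s * a.
  rewrite mulr_sumr mulr_suml; apply: eq_bigr => i _.
  rewrite mulrA (cX _ z) // -!mulrA; congr (_ * _); exact: cX.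
have E : (z - c%:A) * s = - (c ^+ m)%:A.
  rewrite -subrXX_comm; last exact: comm_c.
  by rewrite zm0 sub0r exprZn expr1n.
have zE : z = (z - c%:A) * (s * (- (c ^+ m)^-1 *: z)).
  rewrite mulrA E mulNr scaleNr mulrN opprK -scalerAl mul1r scalerA.
  by rewrite divff ?scale1r // expf_neq0.
move=> inn; rewrite zE; apply: inner_on_mul inn => a.
by rewrite -!scalerAr -scalerAl mulrA cs -!mulrA cz.
Qed.

End TwistedDerivations.

(** * The fibre of a bimodule and its first order deformation *)

Section TransferMatrices.
Variables (k : fieldType) (R B : algType k).
Variables (eps lam : B -> k).
Hypotheses (eps_lin : scalar eps) (lam_lin : scalar lam).
Hypothesis epsM : forall b c, eps (b * c) = eps b * eps c.
Hypothesis lamM : forall b c, lam (b * c) = eps b * lam c + lam b * eps c.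

Section Bimodule.
Variables (P : bimodule R B) (n : nat) (e : 'I_n -> P) (f : 'I_n -> P -> B).
Hypothesis ef : right_dual_basis e f.

(** The pair (fibre v, tangent v) represents the class of v in P (x)_B k[t],
    where t^2 = 0 and B acts on k[t] through b |-> eps b + lam b t.  The fibre
    alone represents the class of v in P / P ker(eps).  Left multiplication by
    a acts on this pair through [fibre_mx a] + t [tangent_mx a]. *)
Definition fibre (v : P) : 'cV[k]_n := \col_i eps (f i v).
Definition tangent (v : P) : 'cV[k]_n := \col_i lam (f i v).
Definition fibre_mx (a : R) : 'M[k]_n :=
  \matrix_(i, j) fibre (lact a (e j)) i 0.
Definition tangent_mx (a : R) : 'M[k]_n :=
  \matrix_(i, j) tangent (lact a (e j)) i 0.

Let f_lin i : linear (f i). Proof. by case: ef. Qed.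
Let f_ract i v b : f i (ract v b) = f i v * b. Proof. by case: ef. Qed.
Let ef_sum v : v = \sum_i ract (e i) (f i v). Proof. by case: ef. Qed.

Lemma fibre_lin : linear fibre.
Proof. by move=> c u v; apply/matrixP => i j; rewrite !mxE f_lin eps_lin. Qed.

Lemma tangent_lin : linear tangent.
Proof. by move=> c u v; apply/matrixP => i j; rewrite !mxE f_lin lam_lin. Qed.

Lemma fibre_ract v b : fibre (ract v b) = eps b *: fibre v.
Proof. by apply/matrixP => i j; rewrite !mxE f_ract epsM mulrC. Qed.

Lemma coord_lact i a v : f i (lact a v) = \sum_j f i (lact a (e j)) * f j v.
Proof.
rewrite {1}(ef_sum v) (lin_sum (lact_linearr a)) (lin_sum (f_lin i)).
by apply: eq_bigr => j _; rewrite -lractA f_ract.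
Qed.

Lemma fibre_lact a v : fibre (lact a v) = fibre_mx a *m fibre v.
Proof.
apply/matrixP => i j; rewrite !mxE coord_lact (form_sum eps_lin).
by apply: eq_bigr => l _; rewrite !mxE epsM.
Qed.

Lemma tangent_lact a v :
  tangent (lact a v) = tangent_mx a *m fibre v + fibre_mx a *m tangent v.
Proof.
apply/matrixP => i j; rewrite !mxE coord_lact (form_sum lam_lin) -big_split.
by apply: eq_bigr => l _; rewrite !mxE lamM addrC.
Qed.

Lemma col_fibre_mx j a : col j (fibre_mx a) = fibre (lact a (e j)).
Proof. by apply/matrixP => i l; rewrite !mxE. Qed.

Lemma col_tangent_mx j a : col j (tangent_mx a) = tangent (lact a (e j)).
Proof. by apply/matrixP => i l; rewrite !mxE. Qed.

Lemma fibre_mxM a b : fibre_mx (a * b) = fibre_mx a *m fibre_mx b.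
Proof.
apply: eq_cols => j.
by rewrite col_mulmx !col_fibre_mx lactM fibre_lact.
Qed.

Lemma tangent_mxM a b :
  tangent_mx (a * b) = tangent_mx a *m fibre_mx b + fibre_mx a *m tangent_mx b.
Proof.
apply: eq_cols => j.
rewrite [RHS]linearD /= !col_mulmx !(col_fibre_mx, col_tangent_mx).
by rewrite lactM tangent_lact.
Qed.

Lemma tangent_mx_lin : linear tangent_mx.
Proof.
move=> c a b; apply/matrixP => i j; rewrite !mxE.
by rewrite lact_linearl f_lin lam_lin.
Qed.

(** (s, U) is an R-linear map from the fibre of P to its first order
    deformation that lifts the endomorphism s of the fibre. *)
Definition extension_lift (s U : P -> 'cV[k]_n) : Prop :=
  [/\ linear U, forall v b, U (ract v b) = eps b *: U v
    & forall a v, U (lact a v) = tangent_mx a *m s v + fibre_mx a *m U v].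

(** U only depends on the fibre, and its matrix is the u that is required. *)
Lemma inner_of_lift z U :
  extension_lift (fun v => fibre (lact z v)) U ->
  inner_on fibre_mx tangent_mx z.
Proof.
move=> [U_lin UB UR]; pose u : 'M[k]_n := \matrix_(i, j) U (e j) i 0.
have col_u j : col j u = U (e j) by apply/matrixP => i l; rewrite !mxE (ord1 l).
have uE v : u *m fibre v = U v.
  rewrite {2}(ef_sum v) (lin_sum U_lin); apply/matrixP => i j.
  rewrite !mxE summxE (ord1 j); apply: eq_bigr => l _.
  by rewrite UB !mxE mulrC.
exists u => a; apply: eq_cols => j; rewrite [RHS]linearB /= !col_mulmx.
rewrite !col_fibre_mx col_u uE UR (addrC (_ *m _)).
by rewrite addrAC subrr add0r.
Qed.

(** s, as an endomorphism of P / P ker(eps), is the composite of maps G to and w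
    from a free R-module of finite rank. *)
Definition factors_through_free (s : P -> 'cV[k]_n) : Prop :=
  exists (I : finType) (G : I -> P -> R) (w : I -> P),
  [/\ forall i, linear (G i), forall i a v, G i (lact a v) = a * G i v,
      forall i v b, G i (ract v b) = eps b *: G i v
    & forall v, s v = fibre (\sum_i lact (G i v) (w i))].

(** A map from a free module lifts along any surjection: lift the images of the
    basis, here by keeping the elements [w i] of P themselves. *)
Lemma lift_of_factorization s :
  factors_through_free s -> exists U, extension_lift s U.
Proof.
move=> [I [G [w [G_lin GR GB s_def]]]].
exists (fun v => tangent (\sum_i lact (G i v) (w i))).
have sum_lin : linear (fun v => \sum_i lact (G i v) (w i)).
  move=> c u v; rewrite scaler_sumr -big_split; apply: eq_bigr => i _.
  by rewrite G_lin lact_linearl.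
split=> [c u v|v b|a v]; first by rewrite sum_lin tangent_lin.
- rewrite -(lin_scale tangent_lin) scaler_sumr; congr tangent.
  by apply: eq_bigr => i _; rewrite GB lactZl.
- rewrite s_def -tangent_lact (lin_sum (lact_linearr a)); congr tangent.
  by apply: eq_bigr => i _; rewrite GR lactM.
Qed.

Lemma inner_of_factorization z :
  factors_through_free (fun v => fibre (lact z v)) ->
  inner_on fibre_mx tangent_mx z.
Proof. by move=> /lift_of_factorization [U]; exact: inner_of_lift. Qed.

Lemma eq_factors s s' :
  s =1 s' -> factors_through_free s -> factors_through_free s'.
Proof.
move=> ss' [I [G [w [? ? ? s_def]]]].
by exists I, G, w; split=> // v; rewrite -ss'.
Qed.

Lemma factorsD s s' :
  factors_through_free s -> factors_through_free s' ->
  factors_through_free (fun v => s v + s' v).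
Proof.
move=> [I [G [w [G_lin GR GB s_def]]]] [I' [G' [w' [G'_lin G'R G'B s'_def]]]].
exists (I + I')%type, (fun i => match i with inl i => G i | inr i => G' i end),
  (fun i => match i with inl i => w i | inr i => w' i end).
split=> [[]|[]|[]|v] //.
by rewrite s_def s'_def big_sumType (lin_add fibre_lin).
Qed.

End Bimodule.
End TransferMatrices.

(** * The transfer of a trace form *)

Section RightLinearMaps.
Variables (k : fieldType) (R S B : algType k).
Variables (P : bimodule R B) (Q : bimodule S B).

Definition right_hom (phi : P -> Q) : Prop :=
  linear phi /\ forall v b, phi (ract v b) = ract (phi v) b.

Variables (I : finType) (e : I -> P) (f : I -> P -> B).
Hypothesis ef : right_dual_basis e f.

Lemma right_hom_expand phi v :
  right_hom phi -> phi v = \sum_i ract (phi (e i)) (f i v).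
Proof.
move=> [phi_lin phiB]; have [_ _ ef_sum] := ef.
by rewrite {1}(ef_sum v) (lin_sum phi_lin); apply: eq_bigr => i _.
Qed.

End RightLinearMaps.

Lemma right_hom_comp (k : fieldType) (R S T B : algType k) (P : bimodule R B)
    (Q : bimodule S B) (V : bimodule T B) (phi : Q -> V) (psi : P -> Q) :
  right_hom phi -> right_hom psi -> right_hom (phi \o psi).
Proof.
move=> [phi_lin phiB] [psi_lin psiB].
by split=> [|v b]; [exact: linear_comp | rewrite /= psiB phiB].
Qed.

Lemma right_hom_lact (k : fieldType) (R B : algType k) (P : bimodule R B) a :
  right_hom (lact a : P -> P).
Proof. by split=> [|v b]; [exact: lact_linearr | rewrite lractA]. Qed.

Lemma bimod_right_hom (k : fieldType) (R B : algType k) (P Q : bimodule R B)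
    (phi : P -> Q) :
  bimod_hom phi -> right_hom phi.
Proof. by case. Qed.

Section Transfer.
Variables (k : fieldType) (B : algType k) (lam : B -> k).
Hypothesis lam_lin : scalar lam.
Hypothesis lamC : forall b c, lam (b * c) = lam (c * b).

(** The Hattori-Stallings trace of phi, to which lam is applied. *)
Definition transfer (R : algType k) (P : bimodule R B) (I : finType)
    (e : I -> P) (f : I -> P -> B) (phi : P -> P) : k :=
  \sum_i lam (f i (phi (e i))).

Lemma transfer_comp (R S : algType k) (P : bimodule R B) (Q : bimodule S B)
    (I J : finType) (e : I -> P) (f : I -> P -> B)
    (e' : J -> Q) (f' : J -> Q -> B)
    (phi : Q -> P) (psi : P -> Q) :
  right_dual_basis e f -> right_dual_basis e' f' ->
  right_hom phi -> right_hom psi ->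
  transfer e f (phi \o psi) =
  \sum_i \sum_j lam (f i (phi (e' j)) * f' j (psi (e i))).
Proof.
move=> ef ef' phi_hom psi_hom; have [f_lin fB _] := ef.
apply: eq_bigr => i _ /=; rewrite (right_hom_expand ef' _ phi_hom).
rewrite (lin_sum (f_lin i)) (form_sum lam_lin).
by apply: eq_bigr => j _; rewrite fB.
Qed.

Lemma transferC (R S : algType k) (P : bimodule R B) (Q : bimodule S B)
    (I J : finType) (e : I -> P) (f : I -> P -> B)
    (e' : J -> Q) (f' : J -> Q -> B)
    (phi : Q -> P) (psi : P -> Q) :
  right_dual_basis e f -> right_dual_basis e' f' ->
  right_hom phi -> right_hom psi ->
  transfer e f (phi \o psi) = transfer e' f' (psi \o phi).
Proof.
move=> ef ef' phi_hom psi_hom.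
rewrite (transfer_comp ef ef') // (transfer_comp ef' ef) // exchange_big.
by apply: eq_bigr => j _; apply: eq_bigr => i _; rewrite lamC.
Qed.

Lemma transfer_add (R : algType k) (P : bimodule R B) (I : finType)
    (e : I -> P) (f : I -> P -> B) (phi psi : P -> P) :
  right_dual_basis e f ->
  transfer e f (fun v => phi v + psi v) = transfer e f phi + transfer e f psi.
Proof.
move=> [f_lin _ _]; rewrite -big_split; apply: eq_bigr => i _.
by rewrite (lin_add (f_lin i)) (form_add lam_lin).
Qed.

Lemma eq_transfer (R : algType k) (P : bimodule R B) (I : finType)
    (e : I -> P) (f : I -> P -> B) (phi psi : P -> P) :
  phi =1 psi -> transfer e f phi = transfer e f psi.
Proof. by move=> E; apply: eq_bigr => i _; rewrite E. Qed.

Lemma reindex_transfer (R : algType k) (P : bimodule R B) (I : finType)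
    (e : I -> P) (f : I -> P -> B) (phi : P -> P) :
  transfer (fun i : 'I_#|I| => e (enum_val i)) (fun i => f (enum_val i)) phi =
  transfer e f phi.
Proof.
rewrite /transfer -(big_enum_val (fun i => lam (f i (phi (e i))))).
exact: eq_bigl.
Qed.

End Transfer.

Lemma regular_dual_basis (k : fieldType) (B : algType k) :
  @right_dual_basis k B B (regular_bimod B) unit (fun _ => 1) (fun _ => id).
Proof.
split=> // v.
by rewrite (big_pred1 tt) => [|[]] //=; rewrite mul1r.
Qed.

Lemma reindex_dual_basis (k : fieldType) (R B : algType k) (P : bimodule R B)
    (I : finType) (e : I -> P) (f : I -> P -> B) :
  right_dual_basis e f ->
  right_dual_basis (fun i : 'I_#|I| => e (enum_val i))
    (fun i => f (enum_val i)).
Proof.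
move=> [f_lin fB ef_sum]; split=> // v.
rewrite {1}(ef_sum v).
by rewrite -(big_enum_val (fun i => ract (e i) (f i v))); exact: eq_bigl.
Qed.

Lemma retract_dual_basis (k : fieldType) (R S B : algType k)
    (P : bimodule R B) (Q : bimodule S B) (phi : Q -> P) (psi : P -> Q)
    (I : finType) (e : I -> P) (f : I -> P -> B) :
  right_hom phi -> right_hom psi -> (forall v, psi (phi v) = v) ->
  right_dual_basis e f ->
  right_dual_basis (fun i => psi (e i)) (fun i v => f i (phi v)).
Proof.
move=> [phi_lin phiB] psi_hom phiK ef; have [f_lin fB _] := ef.
split=> [i|i v b|v]; first exact: linear_comp.
  by rewrite phiB fB.
by rewrite -{1}(phiK v); exact: right_hom_expand.
Qed.

(** * Tensor products *)

Lemma malgU_scale (R : nzRingType) (K : choiceType) (c : R) (x : K) :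
  << c *g x >> = c *: << x >> :> {malg R[K]}.
Proof. by apply/malgP => y; rewrite mcoeffZ !mcoeffU mulrnAr mulr1. Qed.

Section Tensors.
Variables (k : fieldType) (R S B : algType k).
Variables (M : bimodule R S) (N : bimodule S B).
Local Notation T := (tensor_bimod M N).

(** Scalars are absorbed by the left factor, so sums of pure tensors exhaust the
    tensor product. *)
Lemma tensor_ind (Q : T -> Prop) :
  (forall m n, Q (tens m n)) -> (forall x y, Q x -> Q y -> Q (x + y)) ->
  forall x, Q x.
Proof.
move=> Q_tens Q_add x; rewrite -[x]lq_reprK; move: (lq_repr x) => u.
have Q0 : Q 0.
  suff -> : 0 = tens 0 0 :> T by exact: Q_tens.
  by rewrite (lin0 (tens_linearl 0)).
rewrite (monalgE u) (raddf_sum (lq_pi _)); apply: (big_ind Q) => // -[m n] _.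
set c := u@_(m, n); have E : tens (c *: m) n = lq_pi _ << c *g (m, n) >>.
  by rewrite (lin_scale (tens_linearl n)) /tens malgU_scale linearZZ.
exact: eq_ind (Q_tens _ _) _ E.
Qed.

Lemma tensor_sum (x : T) :
  exists s : seq (M * N), x = \sum_(mn <- s) tens mn.1 mn.2.
Proof.
elim/tensor_ind: x => [m n|_ _ [s ->] [s' ->]].
  by exists [:: (m, n)]; rewrite big_seq1.
by exists (s ++ s'); rewrite big_cat.
Qed.

(** g stands for the action of a on the target, so that the same statement
    serves targets that are bimodules over other algebras, or mere modules. *)
Lemma tensor_lact_ext (W : lmodType k) (phi : T -> W) (g : W -> W) a :
  linear phi -> {morph g : u v / u + v} ->
  (forall m n, phi (tens (lact a m) n) = g (phi (tens m n))) ->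
  forall x, phi (lact a x) = g (phi x).
Proof.
move=> phi_lin gD phi_tens x.
elim/tensor_ind: x => [m n|x y IHx IHy]; first by rewrite /= tensor_lact_tens.
rewrite (lin_add phi_lin x y) gD -IHx -IHy.
by rewrite -(lin_add phi_lin (lact a x) (lact a y)) -[in RHS]lactDr.
Qed.

Lemma tensor_ract_ext (W : lmodType k) (phi : T -> W) (g : W -> W) b :
  linear phi -> {morph g : u v / u + v} ->
  (forall m n, phi (tens m (ract n b)) = g (phi (tens m n))) ->
  forall x, phi (ract x b) = g (phi x).
Proof.
move=> phi_lin gD phi_tens x.
elim/tensor_ind: x => [m n|x y IHx IHy]; first by rewrite /= tensor_ract_tens.
rewrite (lin_add phi_lin x y) gD -IHx -IHy.
by rewrite -(lin_add phi_lin (ract x b) (ract y b)) -[in RHS]ractDl.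
Qed.

Lemma tensor_dual_basis (I J : finType) (e : I -> M) (f : I -> M -> S)
    (e' : J -> N) (f' : J -> N -> B) :
  right_dual_basis e f -> right_dual_basis e' f' ->
  exists g : I * J -> T -> B,
    right_dual_basis (fun ij => tens (e ij.1) (e' ij.2) : T) g /\
    forall ij m n, g ij (tens m n) = f' ij.2 (lact (f ij.1 m) n).
Proof.
move=> [f_lin fS ef_sum] [f'_lin f'B ef'_sum].
pose h (ij : I * J) m n := f' ij.2 (lact (f ij.1 m) n).
have hl ij n : linear (h ij ^~ n).
  by move=> c m m'; rewrite /h f_lin lact_linearl f'_lin.
have hr ij m : linear (h ij m).
  by move=> c n n'; rewrite /h lact_linearr f'_lin.
have hb ij m b n : h ij (ract m b) n = h ij m (lact b n).
  by rewrite /h fS lactM.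
have gE ij m n : tensor_lift (h ij) (tens m n) = h ij m n.
  exact: tensor_lift_tens.
have g_lin ij : linear (tensor_lift (h ij)) by exact: tensor_lift_linear.
exists (fun ij => tensor_lift (h ij)); split=> //; split=> // [ij v b|v].
- apply: (tensor_ract_ext (g := fun c => c * b)) => // [c d|m n].
    by rewrite mulrDl.
  by rewrite !gE /h -lractA f'B.
- elim/tensor_ind: v => [m n|u v IHu IHv]; last first.
    rewrite {1}IHu {1}IHv -big_split; apply: eq_bigr => ij _.
    by rewrite (lin_add (g_lin ij)) ractDr.
  rewrite {1}(ef_sum m) (lin_sum (tens_linearl n)).
  rewrite -(pair_big predT predT (fun i j => ract (tens (e i) (e' j) : T)
    (tensor_lift (h (i, j)) (tens m n)))) /=.
  apply: eq_bigr => i _; rewrite tens_bal (ef'_sum (lact _ n)).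
  rewrite (lin_sum (tens_linearr (e i))); apply: eq_bigr => j _.
  by rewrite tensor_ract_tens gE.
Qed.

End Tensors.

(** * Factorizations of the fibre through free modules *)

Section FibrewiseFactorizations.
Variables (k : fieldType) (B : algType k) (eps : B -> k).
Hypothesis eps_lin : scalar eps.
Hypothesis epsM : forall b c, eps (b * c) = eps b * eps c.

(** phi sends P ker(eps) into Q ker(eps). *)
Lemma eq_fibre_hom (R S : algType k) (P : bimodule R B) (Q : bimodule S B)
    n m (e : 'I_n -> P) (f : 'I_n -> P -> B)
    (e' : 'I_m -> Q) (f' : 'I_m -> Q -> B)
    (phi : P -> Q) u v :
  right_dual_basis e f -> right_dual_basis e' f' -> right_hom phi ->
  fibre eps f u = fibre eps f v -> fibre eps f' (phi u) = fibre eps f' (phi v).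
Proof.
move=> ef ef' phi_hom uv.
have E w : fibre eps f' (phi w) =
    \sum_i (fibre eps f w) i 0 *: fibre eps f' (phi (e i)).
  rewrite (right_hom_expand ef w phi_hom) (lin_sum (fibre_lin eps_lin ef')).
  by apply: eq_bigr => i _; rewrite (fibre_ract epsM ef') mxE.
by rewrite !E uv.
Qed.

Lemma factors_comp (R : algType k) (P Q : bimodule R B)
    n m (e : 'I_n -> P) (f : 'I_n -> P -> B)
    (e' : 'I_m -> Q) (f' : 'I_m -> Q -> B)
    (eta : P -> Q) (kappa : Q -> P) :
  right_dual_basis e f -> right_dual_basis e' f' ->
  bimod_hom eta -> bimod_hom kappa ->
  factors_through_free eps f' (fibre eps f') ->
  factors_through_free eps f (fun v => fibre eps f (kappa (eta v))).
Proof.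
move=> ef ef' [eta_lin etaR etaB] kappa_hom [I [G [w [G_lin GR GB s_def]]]].
exists I, (fun i v => G i (eta v)), (fun i => kappa (w i)).
split=> [i|i a v|i v b|v]; first exact: linear_comp.
- by rewrite etaR GR.
- by rewrite etaB GB.
rewrite (eq_fibre_hom ef' ef (bimod_right_hom kappa_hom) (s_def _)).
have [kappa_lin kappaR _] := kappa_hom.
rewrite (lin_sum kappa_lin); congr fibre.
by apply: eq_bigr => i _; rewrite kappaR.
Qed.

(** The bimodule R (x)_k Y, with R acting on the left factor only, is free on
    the left; Y is its image under multiplication. *)
Section Induced.
Variables (R : algType k) (Y : bimodule R B).

Let scale_lin (V : lmodType k) (v : V) : linear (fun c : k^o => c *: v).
Proof. by move=> c u w; rewrite scalerDl scalerA. Qed.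

Let scaler_lin (V : lmodType k) (c : k) : linear (fun v : V => c *: v).
Proof. by move=> d u w; rewrite scalerDr !scalerA mulrC. Qed.

Definition left_regular : bimodule R k^o :=
  @Bimodule k R k^o R *%R (fun a c => c *: a)
    (@regular_linearl k R) (@regular_linearr k R)
    (@scaler_lin R) (@scale_lin R) (@mul1r R) (@scale1r k R)
    (fun a a' m => esym (mulrA a a' m))
    (fun m c d => etrans (congr1 (fun x => x *: m) (mulrC c d))
                         (esym (scalerA d c m)))
    (fun a m c => scalerAr c a m).

Definition right_restriction : bimodule k^o B :=
  @Bimodule k k^o B Y (fun c y => c *: y) ract
    (@scale_lin Y) (@scaler_lin Y)
    (@ract_linearl k R B Y) (@ract_linearr k R B Y)
    (@scale1r k Y) (@ract1 k R B Y)
    (fun c d m => esym (scalerA c d m)) (@ractM k R B Y)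
    (@ractZl k R B Y).

Definition induced : bimodule R B :=
  tensor_bimod left_regular right_restriction.

Definition induced_mul : induced -> Y :=
  @tensor_lift k R k^o B left_regular right_restriction Y (fun a y => lact a y).

Let mul_linl (y : Y) : linear (fun a : R => lact a y).
Proof. exact: lact_linearl. Qed.
Let mul_linr (a : R) : linear (fun y : Y => lact a y).
Proof. exact: lact_linearr. Qed.
Let mul_bal (a : R) (c : k) (y : Y) : lact (c *: a) y = lact a (c *: y).
Proof. by rewrite lactZl lactZr. Qed.

Lemma induced_mul_tens a y :
  induced_mul (@tens k R k^o B left_regular right_restriction a y) = lact a y.
Proof.
exact: (@tensor_lift_tens k R k^o B left_regular right_restriction Y
  (fun a y => lact a y) mul_linl mul_linr mul_bal).
Qed.

Lemma induced_mul_hom : bimod_hom induced_mul.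
Proof.
have mul_lin : linear induced_mul.
  exact: (@tensor_lift_linear k R k^o B left_regular right_restriction Y
    (fun a y => lact a y) mul_linl mul_linr mul_bal).
split=> // [a v|v b].
- apply: (tensor_lact_ext mul_lin (lactDr a)) => m n.
  by rewrite !induced_mul_tens lactM.
- apply: (tensor_ract_ext mul_lin (ractDl b)) => m n.
  by rewrite !induced_mul_tens lractA.
Qed.

Lemma projective_splits :
  bimod_projective Y ->
  exists2 h : Y -> induced, bimod_hom h & forall y, induced_mul (h y) = y.
Proof.
move=> prY; apply: (prY induced Y induced_mul id) => //.
- exact: induced_mul_hom.
move=> y; exists (@tens k R k^o B left_regular right_restriction 1 y).
by rewrite induced_mul_tens lact1.
Qed.

(** A splitting h of the multiplication R (x)_k Y -> Y, followed by
    a (x) y |-> eps (f_i y) a, gives left linear forms on Y, and these are the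
    coordinates of the fibre of Y with respect to the classes of the [e i]. *)
Lemma projective_factors n (e : 'I_n -> Y) (f : 'I_n -> Y -> B) :
  bimod_projective Y -> right_dual_basis e f ->
  factors_through_free eps f (fibre eps f).
Proof.
move=> /projective_splits [h [h_lin hR hB] hK] ef; have [f_lin fB ef_sum] := ef.
pose c i (a : left_regular) (y : right_restriction) : R :=
  eps (f i y) *: (a : R).
have cl i y : linear (c i ^~ y).
  by move=> d a a'; rewrite /c scalerDr !scalerA mulrC.
have cr i a : linear (c i a).
  by move=> d y y'; rewrite /c f_lin eps_lin scalerDl scalerA.
have cb i a (d : k^o) y : c i (ract a d) y = c i a (lact d y).
  by rewrite /c /= (lin_scale (f_lin i)) (form_scale eps_lin) !scalerA mulrC.
pose C i : induced -> R := tensor_lift (c i).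
have C_lin i : linear (C i).
  by apply: tensor_lift_linear; [exact: cl|exact: cr|exact: cb].
have C_tens i a y : C i (tens a y) = c i a y.
  by apply: tensor_lift_tens; [exact: cl|exact: cr|exact: cb].
exists 'I_n, (fun i y => C i (h y)), e; split=> [i|i a v|i v b|v].
- exact: linear_comp.
- rewrite hR; apply: (tensor_lact_ext (C_lin i) (mulrDr a)) => m y.
  by rewrite !C_tens /c /= scalerAr.
- rewrite hB; apply: (tensor_ract_ext (C_lin i) (scalerDr (eps b))) => m y.
  by rewrite !C_tens /c /= fB epsM scalerA mulrC.
rewrite -{1}(hK v); elim/tensor_ind: (h v) => [a y|u w IHu IHw].
  rewrite induced_mul_tens (right_hom_expand ef y (right_hom_lact Y a)).
  rewrite !(lin_sum (fibre_lin eps_lin ef)); apply: eq_bigr => i _.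
  rewrite C_tens /c lactZl (lin_scale (fibre_lin eps_lin ef)).
  by rewrite (fibre_ract epsM ef).
have [m_lin _ _] := induced_mul_hom.
rewrite (lin_add m_lin) (lin_add (fibre_lin eps_lin ef)) IHu IHw.
rewrite -(lin_add (fibre_lin eps_lin ef)) -big_split; congr fibre.
by apply: eq_bigr => i _; rewrite (lin_add (C_lin i)) lactDl.
Qed.

End Induced.

Section TensorFactorization.
Variables (A : algType k) (M : bimodule A B) (N : bimodule B A).
Local Notation T := (tensor_bimod N M).
Variables (p : tensor_bimod M N -> regular_bimod A).
Hypothesis p_hom : bimod_hom p.

Let p_lin : linear p. Proof. by case: p_hom. Qed.
Let pA a x : p (lact a x) = a * p x. Proof. by case: p_hom. Qed.
Let pA' x a : p (ract x a) = p x * a. Proof. by case: p_hom. Qed.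

(** The map M (x)_B (N (x)_A M) -> M induced by p, for a fixed left factor. *)
Definition contract (m : M) : T -> M :=
  @tensor_lift k B A B N M M (fun n (m' : M) => lact (p (tens m n)) m').

Let contract_linl (m m' : M) : linear (fun n => lact (p (tens m n)) m').
Proof. by move=> c n n'; rewrite tens_linearr p_lin lact_linearl. Qed.
Let contract_linr m n : linear (fun m' : M => lact (p (tens m n)) m').
Proof. exact: lact_linearr. Qed.
Let contract_bal m n a (m' : M) :
  lact (p (tens m (ract n a))) m' = lact (p (tens m n)) (lact a m').
Proof. by rewrite -lactM -pA' /= tensor_ract_tens. Qed.

Lemma contract_tens m n (m' : M) :
  contract m (tens n m') = lact (p (tens m n)) m'.
Proof.
apply: (@tensor_lift_tens k B A B N M M
  (fun n (m' : M) => lact (p (tens m n)) m')).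
- exact: contract_linl.
- exact: contract_linr.
- exact: contract_bal.
Qed.

Lemma contract_right_hom m : right_hom (contract m).
Proof.
have c_lin : linear (contract m).
  apply: tensor_lift_linear; [exact: contract_linl|exact: contract_linr|].
  exact: contract_bal.
split=> // v b; apply: (tensor_ract_ext c_lin (ractDl b)) => n m'.
by rewrite !contract_tens lractA.
Qed.

Lemma contract_linear w : linear (contract^~ w).
Proof.
move=> c m1 m2; elim/tensor_ind: w => [n m'|u v IHu IHv].
  by rewrite !contract_tens tens_linearl p_lin lact_linearl.
by rewrite !(lin_add (proj1 (contract_right_hom _))) IHu IHv scalerDr addrACA.
Qed.

Lemma contract_lact a m w : contract (lact a m) w = lact a (contract m w).
Proof.
elim/tensor_ind: w => [n m'|u v IHu IHv].
  by rewrite !contract_tens -lactM -pA /= tensor_lact_tens.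
by rewrite !(lin_add (proj1 (contract_right_hom _))) IHu IHv lactDr.
Qed.

Lemma contract_ract m b w : contract (ract m b) w = contract m (lact b w).
Proof.
elim/tensor_ind: w => [n m'|u v IHu IHv].
  by rewrite /= tensor_lact_tens !contract_tens tens_bal.
by rewrite lactDr !(lin_add (proj1 (contract_right_hom _))) IHu IHv.
Qed.

(** The functor M (x)_B - takes free B-modules to multiples of the left
    A-module M, which is a summand of a free module, so it preserves the maps
    whose fibre factors through a free module.  Restricting along
    m |-> t (x) m, where t is a central element of M (x)_B N, and corestricting
    along [contract] gives an endomorphism of the fibre of M. *)
Lemma factors_tensor (I : finType) (mu : I -> M) (F : I -> M -> A)
    n (e : 'I_n -> M) (f : 'I_n -> M -> B)
    l (eT : 'I_l -> T) (fT : 'I_l -> T -> B)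
    (theta : T -> T) (t : seq (M * N)) :
  left_dual_basis mu F -> right_dual_basis e f -> right_dual_basis eT fT ->
  (forall a, lact a (\sum_(mn <- t) tens mn.1 mn.2 : tensor_bimod M N) =
             ract (\sum_(mn <- t) tens mn.1 mn.2 : tensor_bimod M N) a) ->
  factors_through_free eps fT (fun w => fibre eps fT (theta w)) ->
  factors_through_free eps f
    (fun m => fibre eps f (\sum_(mn <- t) contract mn.1 (theta (tens mn.2 m)))).
Proof.
move=> [F_lin FA Fmu_sum] ef efT t_central [J [H [v [H_lin HB_ HB' H_def]]]].
exists (I * J)%type,
  (fun ij m => \sum_(mn <- t) F ij.1 (ract mn.1 (H ij.2 (tens mn.2 m)))),
  (fun ij => contract (mu ij.1) (v ij.2)).
split=> [[i j]|[i j] a m|[i j] m b|m] /=.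
- move=> c m m'; rewrite scaler_sumr -big_split; apply: eq_bigr => mn _.
  by rewrite tens_linearr H_lin ract_linearr F_lin.
- pose h (m' : M) (n' : N) : A := F i (ract m' (H j (tens n' m))).
  have hl n' : linear (h^~ n') by move=> c x y; rewrite /h ract_linearl F_lin.
  have hr m' : linear (h m').
    by move=> c x y; rewrite /h tens_linearl H_lin ract_linearr F_lin.
  have hb m' b n' : h (ract m' b) n' = h m' (lact b n').
    rewrite /h -ractM; congr (F i (ract m' _)).
    by rewrite -HB_ /= tensor_lact_tens.
  have L_lin : linear (tensor_lift h) by exact: tensor_lift_linear.
  have L_tens m' n' : tensor_lift h (tens m' n') = h m' n'.
    exact: tensor_lift_tens.
  (* centrality of t is what makes this coefficient left A-linear *)
  transitivity (tensor_lift h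
    (ract (\sum_(mn <- t) tens mn.1 mn.2 : tensor_bimod M N) a)).
    rewrite (lin_sum (ract_linearl a)) (lin_sum L_lin); apply: eq_bigr => mn _.
    by rewrite /= tensor_ract_tens L_tens /h tens_bal.
  rewrite -t_central (lin_sum (lact_linearr a)) (lin_sum L_lin) mulr_sumr.
  apply: eq_bigr => mn _.
  by rewrite /= tensor_lact_tens L_tens /h lractA FA.
- rewrite scaler_sumr; apply: eq_bigr => mn _.
  have -> : tens mn.2 (ract m b) = ract (tens mn.2 m : T) b.
    by rewrite /= tensor_ract_tens.
  by rewrite HB' ractZr (lin_scale (F_lin i)).
rewrite (lin_sum (fibre_lin eps_lin ef)).
have theta_fibre m' w : fibre eps f (contract m' (theta w)) =
    fibre eps f (contract m' (\sum_j lact (H j w) (v j))).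
  exact: eq_fibre_hom efT ef (contract_right_hom m') (H_def w).
rewrite (eq_bigr _ (fun mn _ => theta_fibre mn.1 (tens mn.2 m))).
rewrite -(lin_sum (fibre_lin eps_lin ef)); congr fibre.
rewrite -(pair_big predT predT (fun i j => lact (\sum_(mn <- t)
  F i (ract mn.1 (H j (tens mn.2 m)))) (contract (mu i) (v j)))) /=.
rewrite exchange_big /=.
under [RHS]eq_bigr => j _ do under eq_bigr => i _ do
  rewrite (lin_sum (lact_linearl _)).
under [RHS]eq_bigr => j _ do rewrite exchange_big.
rewrite exchange_big; apply: eq_bigr => mn _.
rewrite (lin_sum (proj1 (contract_right_hom _))); apply: eq_bigr => j _.
rewrite -contract_ract {1}(Fmu_sum (ract _ _)) (lin_sum (contract_linear _)).
by apply: eq_bigr => i _; rewrite contract_lact.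
Qed.

End TensorFactorization.
End FibrewiseFactorizations.

(** * Transfer along a stable equivalence *)

Section StableEquivalence.
Variables (k : fieldType).

Lemma bimod_hom_inv (A B : algType k) (P Q : bimodule A B) (f : P -> Q)
    (g : Q -> P) :
  bimod_hom f -> cancel f g -> cancel g f -> bimod_hom g.
Proof.
move=> [f_lin fR fB] fK gK; split=> [c u v|a v|v b]; apply: (can_inj fK).
- by rewrite f_lin !gK.
- by rewrite fR !gK.
- by rewrite fB !gK.
Qed.

(** An isomorphism of T with B + Y amounts to the projections beta, eta and the
    injections; that of B is determined by the image s of 1. *)
Lemma regular_summand (B : algType k) (T Y : bimodule B B) :
  bimod_iso T (dsum_bimod (regular_bimod B) Y) ->
  exists (beta : T -> regular_bimod B) (s : T) (eta : T -> Y) (kappa : Y -> T),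
  [/\ bimod_hom beta /\ beta s = 1, forall b, lact b s = ract s b,
      bimod_hom eta /\ bimod_hom kappa, cancel kappa eta
    & forall w, w = lact (beta w) s + kappa (eta w)].
Proof.
move=> [phi phi_hom [psi phiK psiK]].
have psi_hom := bimod_hom_inv phi_hom phiK psiK.
have [[phi_lin phiR phiB] [psi_lin psiR psiB]] := (phi_hom, psi_hom).
exists (fun w => (phi w).1), (psi (1, 0)), (fun w => (phi w).2),
  (fun y => psi (0, y)).
split; first split.
- by split=> [c u v|a v|v b]; rewrite ?phi_lin ?phiR ?phiB.
- by rewrite psiK.
- move=> b; rewrite -psiR -psiB; congr psi; rewrite /= /dsum_lact /dsum_ract /=.
  by rewrite mulr1 mul1r (lin0 (lact_linearr b)) (lin0 (ract_linearl b)).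
- split; first by split=> [c u v|a v|v b]; rewrite ?phi_lin ?phiR ?phiB.
  split=> [c u v|a v|v b]; rewrite -?psi_lin -?psiR -?psiB; congr psi.
  + by congr pair; rewrite /= scaler0 addr0.
  + by rewrite /= /dsum_lact /= mulr0.
  + by rewrite /= /dsum_ract /= mul0r.
- by move=> y; rewrite psiK.
move=> w; rewrite -psiR -(lin_add psi_lin) -{1}(phiK w); congr psi.
rewrite /= /dsum_lact /= mulr1 (lin0 (lact_linearr _)).
by case: (phi w) => b y; congr pair; rewrite /= ?addr0 ?add0r.
Qed.

Section Summand.
Variables (B : algType k) (eps lam : B -> k).
Hypotheses (eps_lin : scalar eps) (lam_lin : scalar lam).
Hypothesis epsM : forall b c, eps (b * c) = eps b * eps c.
Hypothesis lamM : forall b c, lam (b * c) = eps b * lam c + lam b * eps c.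
Variables (T Y : bimodule B B).
Variables (beta : T -> regular_bimod B) (s : T) (eta : T -> Y) (kappa : Y -> T).
Hypotheses (beta_hom : bimod_hom beta) (beta_s : beta s = 1).
Hypothesis s_central : forall b, lact b s = ract s b.
Hypotheses (eta_hom : bimod_hom eta) (kappa_hom : bimod_hom kappa).
Hypothesis kappaK : cancel kappa eta.
Hypothesis T_split : forall w, w = lact (beta w) s + kappa (eta w).
Hypothesis prY : bimod_projective Y.

Let beta_lin : linear beta. Proof. by case: beta_hom. Qed.
Let betaB b w : beta (lact b w) = (b : B) * beta w.
Proof. by case: beta_hom. Qed.
Let betaB' w b : beta (ract w b) = (beta w : B) * b.
Proof. by case: beta_hom. Qed.

Variables (l : nat) (eT : 'I_l -> T) (fT : 'I_l -> T -> B).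
Hypothesis efT : right_dual_basis eT fT.

Let eY i := eta (eT i).
Let fY i y := fT i (kappa y).
Let efY : right_dual_basis eY fY.
Proof. by apply: retract_dual_basis efT => //; exact: bimod_right_hom. Qed.

Let facY : factors_through_free eps fY (fibre eps fY).
Proof. exact: projective_factors efY. Qed.

(** T is B + Y.  An endomorphism of T consists of an endomorphism of B, which is
    multiplication by the central element beta (mid s) and vanishes on the fibre
    by assumption, and of maps that go through Y, whose fibre is projective. *)
Lemma endomorphism_factors (mid : T -> T) :
  bimod_hom mid -> eps (beta (mid s)) = 0 ->
  factors_through_free eps fT (fun w => fibre eps fT (mid w)).
Proof.
move=> mid_hom eps_mid; have [mid_lin midB midB'] := mid_hom.
have [eta_lin etaB etaB'] := eta_hom.
have [kappa_lin kappaB kappaB'] := kappa_hom.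
have mid_s_central b : lact b (mid s) = ract (mid s) b.
  by rewrite -midB s_central midB'.
(* the component B -> Y of mid, preceded by the projection of T to B *)
have eta1_hom : bimod_hom (fun w => eta (lact (beta w) (mid s))).
  split=> [d u v|b v|v b].
  - by rewrite beta_lin lact_linearl eta_lin.
  - by rewrite betaB lactM etaB.
  - by rewrite betaB' lactM mid_s_central -lractA etaB'.
have kappa2_hom : bimod_hom (fun y => mid (kappa y)).
  split=> [|b v|v b]; first exact: linear_comp.
  - by rewrite kappaB midB.
  - by rewrite kappaB' midB'.
have fib_lin := fibre_lin eps_lin efT.
apply: eq_factors (factorsD eps_lin efT
  (factors_comp eps_lin epsM efT efY eta1_hom kappa_hom facY)
  (factors_comp eps_lin epsM efT efY eta_hom kappa2_hom facY)) => w.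
rewrite [in RHS](T_split w) (lin_add mid_lin) midB (lin_add fib_lin).
congr (_ + _).
rewrite [in RHS](T_split (lact _ (mid s))) betaB (lin_add fib_lin).
by rewrite s_central (fibre_ract epsM efT) epsM eps_mid mulr0 scale0r add0r.
Qed.

Lemma transfer_left_mul (P : bimodule B B) d (eP : 'I_d -> P) fP b :
  transfer lam eP fP (lact b) = \tr (tangent_mx lam eP fP b).
Proof. by apply: eq_bigr => i _; rewrite !mxE. Qed.

(** The fibre of Y is a projective left B-module, so the deformation that lam
    defines on it splits. *)
Lemma projective_transfer b : transfer lam eY fY (lact b) = 0.
Proof.
rewrite transfer_left_mul; apply: (mxtrace_inner1 (rho := fibre_mx eps eY fY)).
- exact: fibre_mxM.
- exact: tangent_mxM.
- apply: (inner_of_factorization lam_lin lamM efY).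
  by apply: eq_factors facY => y; rewrite lact1.
Qed.

(** Left multiplication by b on T is the sum of a map through B and a map
    through Y.  As the transfer only depends on a composite up to cyclic
    permutation, the first contributes the transfer of left multiplication by b
    on B, and the second that on Y, which is 0. *)
Lemma transfer_regular_summand b : transfer lam eT fT (lact b) = lam b.
Proof.
have lamC x y : lam (x * y) = lam (y * x).
  by rewrite !lamM addrC mulrC [X in _ + X]mulrC.
have phi_hom : right_hom (fun x : regular_bimod B => lact x s).
  split=> [|x y]; first exact: lact_linearl.
  by rewrite lractA -s_central -lactM.
have bphi_hom := right_hom_comp (right_hom_lact T b) phi_hom.
have bkappa_hom :=
  right_hom_comp (right_hom_lact T b) (bimod_right_hom kappa_hom).
transitivity (transfer lam eT fT (fun w =>
  ((lact b \o (fun x : regular_bimod B => lact x s)) \o beta) w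
  + ((lact b \o kappa) \o eta) w)).
  by apply: eq_transfer => w; rewrite [in LHS](T_split w) lactDr.
rewrite (transfer_add lam_lin _ _ efT).
rewrite (transferC lam_lin lamC efT (regular_dual_basis B) bphi_hom
  (bimod_right_hom beta_hom)).
rewrite (transferC lam_lin lamC efT efY bkappa_hom
  (bimod_right_hom eta_hom)).
rewrite [X in _ + X](_ : _ = 0) ?addr0; last first.
  rewrite -[RHS](projective_transfer b); apply: eq_transfer => y.
  by case: eta_hom => _ etaB _; rewrite /= etaB kappaK.
rewrite /transfer (big_pred1 tt) => [|[]] //.
by rewrite /comp lact1 betaB beta_s mulr1.
Qed.

End Summand.

Section Middle.
Variables (A B : algType k) (M : bimodule A B) (N : bimodule B A) (z : A).
Local Notation T := (tensor_bimod N M).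

(** The action of z on N (x)_A M by n (x) m |-> n z (x) m, written on the right
    factor. *)
Definition middle : T -> T :=
  @tensor_lift k B A B N M T (fun n m => tens n (lact z m)).

Hypothesis z_central : forall a, a * z = z * a.

Let middle_linl (m : M) : linear (fun n : N => tens n (lact z m)).
Proof. exact: tens_linearl. Qed.
Let middle_linr (n : N) : linear (fun m : M => tens n (lact z m)).
Proof. by move=> c m m'; rewrite lact_linearr tens_linearr. Qed.
Let middle_bal (n : N) a (m : M) :
  tens (ract n a) (lact z m) = tens n (lact z (lact a m)).
Proof. by rewrite tens_bal -!lactM z_central. Qed.

Lemma middle_tens n m : middle (tens n m) = tens n (lact z m).
Proof.
apply: (@tensor_lift_tens k B A B N M T (fun n m => tens n (lact z m))).
- exact: middle_linl.
- exact: middle_linr.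
- exact: middle_bal.
Qed.

Lemma middle_hom : bimod_hom middle.
Proof.
have mid_lin : linear middle.
  apply: tensor_lift_linear; [exact: middle_linl|exact: middle_linr|].
  exact: middle_bal.
split=> [|b v|v b]; first exact: mid_lin.
- apply: (tensor_lact_ext mid_lin (lactDr b)) => n m.
  by rewrite !middle_tens /= tensor_lact_tens.
- apply: (tensor_ract_ext mid_lin (ractDl b)) => n m.
  by rewrite !middle_tens /= tensor_ract_tens lractA.
Qed.

End Middle.

Section CentralElements.
Variables (A B : algType k) (eps lam : B -> k).
Hypotheses (eps_lin : scalar eps) (lam_lin : scalar lam).
Hypothesis epsM : forall b c, eps (b * c) = eps b * eps c.
Hypothesis lamM : forall b c, lam (b * c) = eps b * lam c + lam b * eps c.
Hypothesis eps1 : eps 1 = 1.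

Variables (M : bimodule A B) (N : bimodule B A).
Variables (X : bimodule A A) (Y : bimodule B B).
Hypothesis isoA : bimod_iso (tensor_bimod M N) (dsum_bimod (regular_bimod A) X).
Hypothesis isoB : bimod_iso (tensor_bimod N M) (dsum_bimod (regular_bimod B) Y).
Hypothesis prY : bimod_projective Y.
Variables (I : finType) (mu : I -> M) (F : I -> M -> A).
Hypothesis muF : left_dual_basis mu F.
Variables (n : nat) (e : 'I_n -> M) (f : 'I_n -> M -> B).
Hypothesis ef : right_dual_basis e f.
Variables (m : nat) (eN : 'I_m -> N) (fN : 'I_m -> N -> A).
Hypothesis efN : right_dual_basis eN fN.

Local Notation T := (tensor_bimod N M).
Local Notation rho := (fibre_mx eps e f).
Local Notation D := (tangent_mx lam e f).

Lemma middle_sub z (c : k) (w : T) :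
  (forall a, a * z = z * a) -> middle (z - c%:A) w = middle z w - c *: w.
Proof.
move=> cz; have cz' a : a * (z - c%:A) = (z - c%:A) * a.
  by rewrite mulrBr mulrBl cz mulr_algl mulr_algr.
have [[z_lin _ _] [z'_lin _ _]] := (middle_hom M N cz, middle_hom M N cz').
elim/tensor_ind: w => [x y|u v IHu IHv].
  rewrite !middle_tens // (_ : lact _ y = - c *: y + lact z y).
    by rewrite tens_linearr scaleNr addrC.
  by rewrite addrC lactDl -scaleNr lactZl lact1 addrC.
by rewrite (lin_add z_lin) (lin_add z'_lin) IHu IHv scalerDr opprD addrACA.
Qed.

(** The scalar c is the residue of the component B -> B of the action of z on
    N (x)_A M = B + Y.  Removing it makes that action factor through a free
    module on the fibre; tensoring with M and using M (x)_B N = A + X brings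
    this back to the action of z - c on M. *)
Lemma central_shift_inner z :
  (forall a, a * z = z * a) ->
  exists c : k, inner_on rho D (z - c%:A).
Proof.
move=> cz.
have [p [t [_ [_ [[p_hom pt1] t_central _ _ _]]]]] := regular_summand isoA.
have [beta [s [eta [kappa [[beta_hom beta_s] s_central [eta_hom kappa_hom]
  kappaK T_split]]]]] := regular_summand isoB.
have [t_seq t_def] := tensor_sum t.
have [l [eT [fT efT]]] : exists l (eT : 'I_l -> T) fT, right_dual_basis eT fT.
  have [g [eg _]] := tensor_dual_basis efN ef.
  by do 3!eexists; exact: reindex_dual_basis eg.
pose c := eps (beta (middle z s)); exists c.
pose z' := z - c%:A.
have cz' a : a * z' = z' * a by rewrite mulrBr mulrBl cz mulr_algl mulr_algr.
have eps_mid : eps (beta (middle z' s)) = 0.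
  have [beta_lin _ _] := beta_hom.
  rewrite middle_sub // -scaleNr addrC beta_lin beta_s eps_lin eps1 mulr1.
  by rewrite addNr.
have fac_mid := endomorphism_factors eps_lin epsM beta_hom s_central
  eta_hom kappa_hom kappaK T_split prY efT (middle_hom M N cz') eps_mid.
apply: (inner_of_factorization lam_lin lamM ef).
have := factors_tensor eps_lin epsM p_hom muF ef efT (t := t_seq)
  (theta := middle z') _ fac_mid.
rewrite -t_def => /(_ t_central).
apply: eq_factors => v; congr fibre.
transitivity (lact (p t) (lact z' v)); last by rewrite pt1 lact1.
have [p_lin _ _] := p_hom.
rewrite t_def (lin_sum p_lin) (lin_sum (lact_linearl _)).
by apply: eq_bigr => mn _; rewrite middle_tens // contract_tens.
Qed.

Lemma central_nilpotent_inner z d :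
  (forall a, a * z = z * a) -> z ^+ d = 0 -> inner_on rho D z.
Proof.
move=> cz zd0; have [c] := central_shift_inner cz.
apply: inner_on_nilpotent zd0 => //.
exact: fibre_mxM.
Qed.

(** The coordinates of N (x)_A M are products of those of N and of M, so the
    transfer of lam along N (x)_A M is the transfer along N of its transfer
    along M. *)
Lemma form_transfer b :
  lam b = \sum_i \tr (D (fN i (lact b (eN i)))).
Proof.
have [beta [s [eta [kappa [[beta_hom beta_s] s_central [eta_hom kappa_hom]
  kappaK T_split]]]]] := regular_summand isoB.
have [g [eg gE]] := tensor_dual_basis efN ef.
rewrite -(transfer_regular_summand eps_lin lam_lin epsM lamM beta_hom beta_s
  s_central eta_hom kappa_hom kappaK T_split prY (reindex_dual_basis eg)).
transitivity (transfer lam (fun ij => tens (eN ij.1) (e ij.2) : T) g (lact b)).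
  exact: reindex_transfer.
rewrite [RHS](eq_bigr (fun i =>
  \sum_j lam (f j (lact (fN i (lact b (eN i))) (e j))))).
  rewrite pair_bigA; apply: eq_bigr => ij _.
  by rewrite /= tensor_lact_tens gE.
by move=> i _; apply: eq_bigr => j _; rewrite !mxE.
Qed.

End CentralElements.
End StableEquivalence.

(** * Trace forms on the quantum complete intersection *)

Lemma quantum_commX (k : fieldType) (A : algType k) (q : k) (x y : A) i j :
  y * x = q *: (x * y) -> y ^+ j * x ^+ i = q ^+ (i * j) *: (x ^+ i * y ^+ j).
Proof.
move=> yx.
have yX l : y * x ^+ l = q ^+ l *: (x ^+ l * y).
  elim: l => [|l IH]; first by rewrite !expr0 mulr1 mul1r scale1r.
  by rewrite exprSr mulrA IH -scalerAl -!mulrA yx -!scalerAr scalerA -exprSr.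
elim: j => [|j IH]; first by rewrite muln0 !expr0 mulr1 mul1r scale1r.
rewrite [in LHS]exprS -mulrA IH -scalerAr mulrA yX -scalerAl scalerA -exprD.
by rewrite -mulrA -exprS mulnS addnC.
Qed.

(** By the relation yx = qxy every word in the generators is a scalar multiple
    of some x^i y^j.  The span of these monomials is phrased as an induction
    principle on A. *)
Lemma qci_generators (k : fieldType) (p : nat) (q : k) (A : algType k) :
  is_qci p q A ->
  exists x y : A, [/\ x ^+ p = 0, y ^+ p = 0, y * x = q *: (x * y)
    & forall S : A -> Prop, (forall i j, S (x ^+ i * y ^+ j)) ->
        (forall c u v, S u -> S v -> S (c *: u + v)) -> forall a, S a].
Proof.
move=> [f f_surj f_ker].
pose gx : {malg k[{fmonom bool}]} := << fmu false >>.
pose gy : {malg k[{fmonom bool}]} := << fmu true >>.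
have rel0 u : qci_rel p q u -> f u = 0.
  by move=> ru; apply/f_ker => I _; apply.
have fx : f gx ^+ p = 0 by rewrite -rmorphXn; apply/rel0/QciX.
have fy : f gy ^+ p = 0 by rewrite -rmorphXn; apply/rel0/QciY.
have fyx : f gy * f gx = q *: (f gx * f gy).
  apply/eqP; rewrite -subr_eq0 -!rmorphM -linearZZ -raddfB.
  by apply/eqP/rel0/QciXY.
exists (f gx), (f gy); split=> // S S_mon S_lin a.
have S0 : S 0.
  have := S_lin (-1) _ _ (S_mon 0 0)%N (S_mon 0 0)%N.
  by rewrite scaleN1r addNr.
have f_word w : exists c i j, f << FMonom w >> = c *: (f gx ^+ i * f gy ^+ j).
  elim: w => [|l w [c [i [j IH]]]].
    exists 1, 0%N, 0%N; rewrite !expr0 scale1r mulr1 -(rmorph1 f).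
    congr (f << _ >>).
    by apply/eqP; rewrite fmP fm1.
  have -> : << FMonom (l :: w) >> = << fmu l >> * << FMonom w >>
      :> {malg k[{fmonom bool}]}.
    rewrite malgM_def fgmulUU mulr1; congr << _ >>.
    by rewrite /mul /= fmmulE fmuE.
  rewrite rmorphM /= IH; case: l.
    exists (c * q ^+ i), i, j.+1.
    rewrite -scalerAr mulrA -[f gy]expr1 (quantum_commX i 1 fyx) muln1 expr1.
    by rewrite -scalerAl scalerA exprS mulrA.
  by exists c, i.+1, j; rewrite -scalerAr mulrA -exprS.
have [u <-] := f_surj a; rewrite (monalgE u) raddf_sum.
apply: (big_ind S) => // [v w Sv Sw|m _].
  by rewrite -(scale1r v); exact: S_lin.
have [c [i [j E]]] := f_word (fmonom_val m); rewrite fmK in E.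
rewrite malgU_scale /= linearZZ /= E scalerA -[X in S X]addr0; exact: S_lin.
Qed.

Section QuantumPlaneTraces.
Variables (k : fieldType) (A : algType k) (p e n : nat) (q : k) (x y : A).
Hypothesis q_prim : e.-primitive_root q.
Hypotheses (xp : x ^+ p = 0) (yp : y ^+ p = 0) (yx : y * x = q *: (x * y)).
Hypothesis A_ind : forall S : A -> Prop, (forall i j, S (x ^+ i * y ^+ j)) ->
  (forall c u v, S u -> S v -> S (c *: u + v)) -> forall a, S a.

Lemma central_exp_x i : (e %| i)%N -> forall a, a * x ^+ i = x ^+ i * a.
Proof.
move=> ei; apply: A_ind => [l j|c u v cu cv].
  rewrite -mulrA (quantum_commX _ _ yx) exprM.
  have /eqP -> : q ^+ i == 1 by rewrite -(prim_order_dvd q_prim).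
  by rewrite expr1n scale1r !mulrA -!exprD addnC.
by rewrite mulrDl mulrDr -scalerAl -scalerAr cu cv.
Qed.

Lemma central_exp_y j : (e %| j)%N -> forall a, a * y ^+ j = y ^+ j * a.
Proof.
move=> ej; apply: A_ind => [i l|c u v cu cv].
  rewrite mulrA (quantum_commX _ _ yx) mulnC exprM.
  have /eqP -> : q ^+ j == 1 by rewrite -(prim_order_dvd q_prim).
  by rewrite expr1n scale1r -!mulrA -!exprD addnC.
by rewrite mulrDl mulrDr -scalerAl -scalerAr cu cv.
Qed.

Variables (rho D : A -> 'M[k]_n).
Hypothesis rhoM : forall a b, rho (a * b) = rho a *m rho b.
Hypothesis D_lin : linear D.
Hypothesis DM : forall a b, D (a * b) = D a *m rho b + rho a *m D b.
Hypothesis central_inner : forall z,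
  (forall a, a * z = z * a) -> z ^+ p = 0 -> inner_on rho D z.

Let trD_lin : scalar (fun a => \tr (D a)).
Proof. by move=> c u v; rewrite D_lin linearP. Qed.

Let exp_nilpotent (z : A) i : z ^+ p = 0 -> (0 < i)%N -> (z ^+ i) ^+ p = 0.
Proof. by move=> zp i_gt0; rewrite exprAC zp expr0n -(prednK i_gt0). Qed.

Let inner_exp_x i : (0 < i)%N -> (e %| i)%N -> inner_on rho D (x ^+ i).
Proof.
move=> i0 ei; apply: central_inner (exp_nilpotent xp i0).
exact: central_exp_x.
Qed.

Let inner_exp_y i : (0 < i)%N -> (e %| i)%N -> inner_on rho D (y ^+ i).
Proof.
move=> i0 ei; apply: central_inner (exp_nilpotent yp i0).
exact: central_exp_y.
Qed.

(** u v and v u have the same trace, and one is a multiple of the other. *)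
Lemma mxtrace_der_twisted u v (c : k) :
  c != 1 -> v * u = c *: (u * v) -> \tr (D (u * v)) = 0.
Proof.
move=> c_neq1 vu; have := mxtrace_der_comm DM v u.
rewrite vu (form_scale trD_lin) => /eqP.
rewrite -subr_eq0 -[X in _ - X]mul1r -mulrBl mulf_eq0 subr_eq0 (negPf c_neq1).
by move/eqP.
Qed.

Lemma mxtrace_der_monomial i j :
  (0 < i)%N -> (0 < j)%N -> \tr (D (x ^+ i * y ^+ j)) = 0.
Proof.
move=> i0 j0; have [ej|nej] := boolP (e %| j)%N; last first.
  have nq : q ^+ j != 1 by rewrite -(prim_order_dvd q_prim).
  rewrite -(prednK i0) exprS -mulrA; apply: (mxtrace_der_twisted nq).
  rewrite -mulrA (quantum_commX 1 j yx) mul1n expr1 -scalerAr.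
  by rewrite !mulrA -exprSr -exprS.
have [ei|nei] := boolP (e %| i)%N; last first.
  have nq : q ^+ i != 1 by rewrite -(prim_order_dvd q_prim).
  rewrite -(prednK j0) exprSr mulrA; apply: (mxtrace_der_twisted nq).
  rewrite mulrA (quantum_commX i 1 yx) muln1 expr1 -scalerAl.
  by rewrite -!mulrA -exprSr -exprS.
apply: (mxtrace_der_mul rhoM DM); first exact: central_exp_x.
  exact: inner_exp_x.
exact: inner_exp_y.
Qed.

Lemma mxtrace_der_eq0 :
  (forall i, (0 < i <= e)%N -> \tr (D (x ^+ i)) = 0) ->
  (forall j, (0 < j <= e)%N -> \tr (D (y ^+ j)) = 0) ->
  forall a, \tr (D a) = 0.
Proof.
have e_gt0 := prim_order_gt0 q_prim.
have trX z : inner_on rho D (z ^+ e) ->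
    (forall i, (0 < i <= e)%N -> \tr (D (z ^+ i)) = 0) ->
    forall i, \tr (D (z ^+ i)) = 0.
  move=> inn small [|i]; first by rewrite expr0 (mxtrace_der1 rhoM DM).
  have [le_ie|lt_ei] := leqP i.+1 e; first exact: small.
  exact: (mxtrace_der_exp_gt rhoM DM lt_ei inn).
move=> /(trX x (inner_exp_x e_gt0 (dvdnn e))) tr_x.
move=> /(trX y (inner_exp_y e_gt0 (dvdnn e))) tr_y.
apply: A_ind => [[|i] [|j]|c u v tru trv].
- by rewrite mulr1 tr_x.
- by rewrite expr0 mul1r tr_y.
- by rewrite expr0 mulr1 tr_x.
- exact: mxtrace_der_monomial.
- by rewrite trD_lin tru trv mulr0 addr0.
Qed.

End QuantumPlaneTraces.

(** * The dimension count *)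

(** If v is not in U, then v - projv U v has a nonzero coordinate, and this
    coordinate is a linear form in v that vanishes on U. *)
Lemma full_of_forms (k : fieldType) (V : vectType k) (U : {vspace V}) :
  (forall lam : V -> k, scalar lam -> (forall u, u \in U -> lam u = 0) ->
     forall v, lam v = 0) ->
  U = fullv.
Proof.
move=> lam0; apply/vspaceP => v; rewrite memvf.
pose b := vbasis {: V}.
have v_proj : v = projv U v.
  apply/eqP; rewrite -subr_eq0; apply/eqP.
  rewrite (coord_vbasis (memvf (v - projv U v))) big1 // => i _.
  rewrite (lam0 (fun w => coord b i (w - projv U w))) ?scale0r //.
    by move=> c u w; rewrite linearP opprD addrACA -scalerBr linearP.
  by move=> u /projv_id ->; rewrite subrr linear0.
by rewrite v_proj memv_proj.
Qed.

(** The product of b - eps b and c - eps c lies in J^2. *)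
Lemma tangent_form_leibniz (k : fieldType) (B : falgType k) (J : {vspace B})
    (eps lam : B -> k) :
  scalar lam -> (forall b, b - (eps b)%:A \in J) -> lam 1 = 0 ->
  (forall b, b \in (J ^+ 2)%VS -> lam b = 0) ->
  forall b c, lam (b * c) = eps b * lam c + lam b * eps c.
Proof.
move=> lam_lin epsJ lam1 lamJ2 b c.
have := lamJ2 _ (memv_mul (epsJ b) (epsJ c)).
rewrite mulrBl !mulrBr !mulr_algl !mulr_algr scalerA.
have lamB u v : lam (u - v) = lam u - lam v.
  by rewrite addrC -scaleN1r lam_lin mulN1r addrC.
rewrite !lamB !(form_scale lam_lin) lam1 mulr0 subr0 => /eqP.
by rewrite -addrA -opprD subr_eq0 => /eqP ->; rewrite addrC (mulrC _ (eps c)).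
Qed.

Theorem corollary1p3 (k : fieldType) (p e : nat) (q : k)
    (A : algType k) (B : falgType k) :
  p \in [pchar k] -> odd p ->
  e.-primitive_root q -> (2 <= e)%N -> (e %| p - 1)%N ->
  is_qci p q A ->
  split_local B -> symmetric_alg B ->
  stable_equiv_Morita A B ->
  (dim_jacobson_layer B <= 2 * e)%N.
Proof.
move=> _ _ q_prim _ _ qciA [eps eps_ker] _.
move=> [M [N [prM prN [X _ isoA] [Y prY isoB]]]].
have [x [y [xp yp yx A_ind]]] := qci_generators qciA.
have [fglM plM fgrM prrM] := prM; have [_ _ fgrN prrN] := prN.
have [n [em [f ef]]] := right_dual_basis_exists fgrM prrM.
have [r [mu [F muF]]] := left_dual_basis_exists fglM plM.
have [m [eN [fN efN]]] := right_dual_basis_exists fgrN prrN.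
have eps_lin : scalar (eps : B -> k) by move=> c u v; rewrite linearP.
have epsM b c : eps (b * c) = (eps b : k) * eps c by rewrite rmorphM.
have eps1 : eps 1 = 1 :> k by rewrite rmorph1.
have epsJ b : b - (eps b : k)%:A \in jacobson B.
  rewrite -eps_ker addrC -scaleN1r scalerA eps_lin eps1 mulr1 mulN1r.
  by rewrite addrC subrr.
pose T a := \sum_i f i (lact a (em i)).
pose s := [seq T (x ^+ i.+1) | i <- iota 0 e] ++
          [seq T (y ^+ i.+1) | i <- iota 0 e].
pose U := (<[1]> + jacobson B ^+ 2 + <<s>>)%VS.
have U_full : U = fullv.
  apply: full_of_forms => lam lam_lin lamU.
  have lam1 : lam 1 = 0.
    by apply/lamU/(subvP (addvSl _ _))/(subvP (addvSl _ _)); exact: memv_line.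
  have lamJ2 b : b \in (jacobson B ^+ 2)%VS -> lam b = 0.
    by move=> bJ; apply/lamU/(subvP (addvSl _ _))/(subvP (addvSr _ _)).
  have lams b : b \in s -> lam b = 0.
    by move=> bs; apply/lamU/(subvP (addvSr _ _)); exact: memv_span.
  have lamM := tangent_form_leibniz lam_lin epsJ lam1 lamJ2.
  have trT a : \tr (tangent_mx lam em f a) = lam (T a).
    by rewrite (form_sum lam_lin); apply: eq_bigr => i _; rewrite !mxE.
  move=> b.
  rewrite (form_transfer eps_lin lam_lin epsM lamM isoB prY ef efN).
  rewrite big1 // => i _.
  apply: (mxtrace_der_eq0 q_prim xp yp yx A_ind (rho := fibre_mx eps em f)).
  - exact: fibre_mxM.
  - exact: tangent_mx_lin.
  - exact: tangent_mxM.
  - move=> z cz zp.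
    exact: (central_nilpotent_inner eps_lin lam_lin epsM lamM eps1
      isoA isoB prY muF ef efN cz zp).
  - move=> [//|l] /= le_le; rewrite trT; apply: lams; rewrite mem_cat.
    by apply/orP; left; apply: map_f; rewrite mem_iota.
  - move=> [//|l] /= le_le; rewrite trT; apply: lams; rewrite mem_cat.
    apply/orP; right; apply: (map_f (fun i => T (y ^+ i.+1))).
    by rewrite mem_iota.
have J_proper : (\dim (jacobson B) < \dim {: B})%N.
  rewrite ltn_neqAle dimvS ?subvf // andbT.
  apply/eqP => dimJ; have /eqP : jacobson B = fullv.
    by apply/eqP; rewrite eqEdim subvf dimJ leqnn.
  move=> /eqP Jfull; have := memvf (1 : B); rewrite -Jfull -eps_ker eps1.
  by rewrite oner_eq0.
have dim_s : (\dim <<s>> <= 2 * e)%N.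
  apply: leq_trans (dim_span _) _.
  by rewrite size_cat !size_map size_iota mul2n addnn.
rewrite /dim_jacobson_layer leq_subLR -ltnS (leq_trans J_proper) // -U_full.
have dimD (V W : {vspace B}) : (\dim (V + W) <= \dim V + \dim W)%N.
  exact: (dimv_add_leqif V W).
apply: leq_trans (dimD _ _) _; rewrite -addSn leq_add //.
apply: leq_trans (dimD _ _) _; rewrite -[X in (_ <= X)%N]add1n leq_add2r.
by rewrite dim_vline leq_b1.
Qed.
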